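(* Let $m\ge2$ be a fixed integer, and let $\lambda=\lambda(d)>0$ satisfy one of the following three assumptions as $d\to\infty$: (sub) $\log d\ll\log(\lambda\kappa_d)\ll d$; (crit) $\log(\lambda\kappa_d)\sim dx$ for some $x\in(0,\infty)$; (sup) $d\ll\log(\lambda\kappa_d)\ll d^{\frac32-\gamma}$ for some $\gamma\in(0,\frac12)$. Let $x:=\lim_{d\to\infty}\frac1d\log(\lambda\kappa_d)\in[0,\infty]$. Then the following holds in probability as $d\to\infty$: (a) if $x=0$, then $h^{(d,m)}_\lambda\sim\sqrt{\frac2d\log(\lambda\kappa_d)}$, i.e. the ratio of the two sides tends to $1$ in probability; (b) if $x\in(0,\infty)$, then $h^{(d,m)}_\lambda\to\sqrt{1-e^{-2x}}$; (c) if $x=\infty$, then $1-h^{(d,m)}_\lambda\sim\frac12(\lambda\kappa_d)^{-\frac2{d+1}}$, i.e. the ratio of the two sides tends to $1$ in probability.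
   Context: $\mathbb B^d$ is the closed Euclidean unit ball of $\mathbb R^d$, $\mathbb S^{d-1}$ the unit sphere, and $\kappa_d=\pi^{d/2}/\Gamma(1+\frac d2)$ is the volume of $\mathbb B^d$. For each $d\ge2$, $\mathcal P^d_\lambda$ is a homogeneous Poisson point process on $\mathbb R^d$ with intensity $\lambda=\lambda(d)>0$ (all defined on a common probability space), and $K^d_\lambda$ is the convex hull of $\mathcal P^d_\lambda\cap\mathbb B^d$. The support function is $h^{(d)}_\lambda(u):=\sup\{\langle u,x\rangle:x\in K^d_\lambda\}$ for $u\in\mathbb S^{d-1}$ (value $-\infty$ if $K^d_\lambda=\emptyset$). For $d\ge m$, $h^{(d,m)}_\lambda:=\inf_{u\in\mathbb S^{d-1}\cap\mathbb R^m}h^{(d)}_\lambda(u)$, where $\mathbb R^m$ is identified with a fixed $m$-dimensional linear subspace of $\mathbb R^d$ (the law does not depend on the choice, by rotational invariance). For nonnegative sequences, $f\ll g$ (or $g\gg f$) means that for every $\varepsilon>0$, $f(d)\le\varepsilon g(d)$ for all large $d$; $f\sim g$ means $|f-g|\ll g$. *)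

(* Defs.v *)
From HB Require Import structures.
From mathcomp Require Import all_boot all_order all_algebra.
From mathcomp Require Import all_classical all_reals all_analysis.
From mathcomp Require Import measurable_realfun.

Set Implicit Arguments.
Unset Strict Implicit.
Unset Printing Implicit Defensive.

Import Order.TTheory GRing.Theory Num.Theory.
Import numFieldNormedType.Exports.

Local Open Scope classical_set_scope.
Local Open Scope ring_scope.

(* The library norm on ['rV[R]_d] is the sup norm, hence the explicit Euclidean
   structure below. *)
Definition dotv (R : realType) (d : nat) (u v : 'rV[R]_d) : R :=
  \sum_(i < d) u 0 i * v 0 i.

Definition enorm (R : realType) (d : nat) (u : 'rV[R]_d) : R :=
  Num.sqrt (dotv u u).

Definition eball (R : realType) (d : nat) (r : R) : set 'rV[R]_d :=
  [set x | enorm x <= r].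
Arguments eball {R} d r.

Definition esphere (R : realType) (d : nat) : set 'rV[R]_d :=
  [set x | enorm x = 1].
Arguments esphere R d : clear implicits.

Definition borel (R : realType) (d : nat) : set_system 'rV[R]_d :=
  <<s [set A : set 'rV[R]_d | open A] >>.

(* d-dimensional Lebesgue measure on Borel sets, as the iterated product of the
   one-dimensional one: the successor case is [product_measure1] (integral of
   the measures of the sections) read through the identification of
   R^(n+1) with R x R^n. *)
Fixpoint leb (R : realType) (d : nat) : set 'rV[R]_d -> \bar R :=
  match d return set 'rV[R]_d -> \bar R with
  | 0 => fun B => (\1_B 0)%:E
  | n.+1 => fun B =>
      (\int[lebesgue_measure]_t
         leb [set y : 'rV[R]_n | B (row_mx (t%:M : 'rV[R]_1) y)])%E
  end.

Definition Gamma (R : realType) (s : R) : R :=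
  \int[lebesgue_measure]_(t in `]0, +oo[) (t `^ (s - 1) * expR (- t)).

Definition kappa (R : realType) (d : nat) : R :=
  pi `^ (d%:R / 2) / Gamma (1 + d%:R / 2).

Definition mutually_independent (dT : measure_display) (T : measurableType dT)
    (R : realType) (P : probability T R) (n : nat)
    (Y : 'I_n -> T -> \bar R) : Prop :=
  forall A : 'I_n -> set (\bar R), (forall i, measurable (A i)) ->
    P (\bigcap_(i in [set: 'I_n]) (Y i @^-1` A i)) =
    (\prod_(i < n) P (Y i @^-1` A i))%E.

Definition npoints (T : Type) (R : realType) (d : nat)
    (X : T -> set 'rV[R]_d) (B : set 'rV[R]_d) (w : T) : \bar R :=
  counting (X w `&` B).

(* A point process is a random locally finite set.  The counts of sets of
   infinite volume are almost surely infinite as a consequence of the finite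
   case.  The second argument of the library's [poisson_prob] is a dummy. *)
Record poisson_process (dT : measure_display) (T : measurableType dT)
    (R : realType) (P : probability T R) (d : nat) (lambda : R)
    (X : T -> set 'rV[R]_d) : Prop := PoissonProcess {
  pp_locally_finite : forall w r, finite_set (X w `&` eball d r) ;
  pp_measurable : forall B, borel B ->
    measurable_fun [set: T] (npoints X B) ;
  pp_poisson : forall B, borel B -> (leb B < +oo)%E ->
    forall k : nat, P [set w | npoints X B w = k%:R%:E] =
      poisson_prob (lambda * fine (leb B)) k [set k] ;
  pp_independent : forall (n : nat) (B : 'I_n -> set 'rV[R]_d),
    (forall i, borel (B i)) -> trivIset [set: 'I_n] B ->
    mutually_independent P (fun i => npoints X (B i)) }.

Definition convex_hull (R : realType) (d : nat) (A : set 'rV[R]_d) :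
    set 'rV[R]_d :=
  smallest (fun C => convex_set C) A.

Definition ball_polytope (T : Type) (R : realType) (d : nat)
    (X : T -> set 'rV[R]_d) (w : T) : set 'rV[R]_d :=
  convex_hull (X w `&` eball d 1).

(* [ereal_sup set0 = -oo], the convention for an empty body. *)
Definition support_function (R : realType) (d : nat) (K : set 'rV[R]_d)
    (u : 'rV[R]_d) : \bar R :=
  ereal_sup [set (dotv u x)%:E | x in K].

Definition min_support (T : Type) (R : realType) (d : nat)
    (X : T -> set 'rV[R]_d) (V : {vspace 'rV[R]_d}) (w : T) : \bar R :=
  ereal_inf [set support_function (ball_polytope X w) u |
             u in esphere R d `&` [set u | u \in V]].

Definition much_less (R : realType) (f g : nat -> R) : Prop :=
  forall eps : R, 0 < eps -> \forall d \near \oo, f d <= eps * g d.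

Definition asymp_equiv (R : realType) (f g : nat -> R) : Prop :=
  much_less (fun d => `|f d - g d|) g.

Definition cvg_in_probability (dT : measure_display) (T : measurableType dT)
    (R : realType) (P : probability T R) (Y : nat -> T -> \bar R) (c : R) :
    Prop :=
  forall eps : R, 0 < eps ->
    P [set w | (eps%:E < `|Y d w - c%:E|)%E] @[d --> \oo] --> 0%E.

(* Main.v *)
Require Import Defs.
From HB Require Import structures.
From mathcomp Require Import all_boot all_order all_algebra.
From mathcomp Require Import all_classical all_reals all_analysis.
From mathcomp Require Import measurable_realfun ring lra.
From mathcomp Require finmap.
Import Order.TTheory GRing.Theory Num.Theory.
Import numFieldNormedType.Exports.
Local Open Scope classical_set_scope.
Local Open Scope ring_scope.
Set Implicit Arguments.
Unset Strict Implicit.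
Unset Printing Implicit Defensive.

(* Let L = ln (lambda * kappa). The mean number of points in the cap of
   height b in the direction u is exp L times the normalised volume of the
   cap. This cap lies in the ball of center b u and squared radius 1 - b^2,
   so the mean is at most exp (L + d/2 ln (1 - b^2)); when this exponent
   tends to -oo, the support function at one fixed direction is already at
   most b. Conversely, the cap of height b + tau contains the central slab of
   width 2 tau of a ball of squared radius 1 - (b + 3 tau)^2, so up to a
   factor tau / 4 its mean number of points is at least exp (L + d/2 ln (1 -
   (b + 3 tau)^2)). A cap is missed with probability exp (- mean), which
   beats the cardinality of a tau-net, even that of a net of the whole sphere
   of R^d; the dimension m only serves to have a direction at all. In each
   regime the exponents change sign at the claimed limit. As P is
   unconstrained on non-measurable sets, the events on the minimal support
   function are first written as countable unions of void events. *)

(** * Volume of Euclidean balls *)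

Section one_dim.
Context {R : realType}.
Local Notation mu := (@lebesgue_measure R).
Local Open Scope ereal_scope.

(* No measurability is needed here nor in [integral_shift]: the integral is a
   supremum over the simple functions below.  Hence [leb] is monotone and
   translation invariant on all sets. *)
Lemma ge0_integral_mono (f g : R -> \bar R) :
  (forall t, 0 <= f t) -> (forall t, f t <= g t) ->
  \int[mu]_t f t <= \int[mu]_t g t.
Proof.
move=> f0 fg; have g0 t : 0 <= g t by exact: le_trans (fg t).
rewrite !ge0_integralTE//; apply: ereal_sup_le => _ [h hf <-].
by exists h => // t; exact: le_trans (fg t).
Qed.

Let affine (r c : R) (t : measurableTypeR R) : measurableTypeR R :=
  (r * t + c)%R.

Let measurable_affine (r c : R) : measurable_fun setT (affine r c).
Proof. by apply: measurable_funD => //; exact: measurable_funM. Qed.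

Let affine_measure (r : {nonneg R}) (c : R) :
    {measure set (measurableTypeR R) -> \bar R} :=
  mscale r (measure_function_pushforward__canonical__measure_function_Measure
    mu (measurable_affine r%:num c)).

(** The image-type measure on the right agrees with [mu] on half-open intervals, and these determine
    Lebesgue measure. *)
Lemma lebesgue_measure_affine (r c : R) (A : set R) (r0 : (0 < r)%R) :
  measurable A -> mu A = affine_measure (NngNum (ltW r0)) c A.
Proof.
move=> mA; set nu := affine_measure _ c.
rewrite (@lebesgue_measure_unique R nu) //.
move=> _ [[a b]] /= _ <-.
rewrite /nu /affine_measure /mscale/= /pushforward.
have -> : affine r c @^-1` `]a, b] =
    `]((a - c) / r)%R, ((b - c) / r)%R]%classic.
  by apply/seteqP; split => t /=;
    rewrite /affine !in_itv/= ltr_pdivrMr// ler_pdivlMr//; lra.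
rewrite !lebesgue_measure_itv/= !lte_fin ltr_pM2r ?invr_gt0// ltrD2r.
case: ifP => ab; last by rewrite mule0.
rewrite -EFinM; congr EFin; field; lra.
Qed.

Lemma integral_affine (r c : R) (f : R -> \bar R) : (0 < r)%R ->
  measurable_fun setT f -> (forall t, 0 <= f t) ->
  \int[mu]_t f t = r%:E * \int[mu]_t f (r * t + c)%R.
Proof.
move=> r0 mf f0.
transitivity (\int[affine_measure (NngNum (ltW r0)) c]_t f t).
  by apply: eq_measure_integral => A mA _; exact: lebesgue_measure_affine.
by rewrite ge0_integral_mscale// ge0_integral_pushforward.
Qed.

Import HBNNSimple.

Lemma integral_shift (c : R) (f : R -> \bar R) : (forall t, 0 <= f t) ->
  \int[mu]_t f (t + c)%R = \int[mu]_t f t.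
Proof.
(* Change of variables is applied to the simple functions below [g] only; shifted, they lie below
   the shifted [g]. The converse inequality is the same one for the shift [- c]. *)
have H (b : R) g : (forall t, 0 <= g t) ->
    \int[mu]_t g t <= \int[mu]_t g (t + b)%R.
  move=> g0; rewrite [leLHS]ge0_integralTE//;
    apply: ge_ereal_sup => _ [h hg <-].
  have := integral_nnsfun mu measurableT h; rewrite patch_setT => <-.
  rewrite [leLHS](@integral_affine 1 b); last 3 first.
  - by [].
  - apply/measurable_EFinP.
    exact: (@measurable_funPT _ _ (measurableTypeR R) R h).
  - by move=> t; rewrite lee_fin.
  rewrite mul1e; apply: ge0_integral_mono => t; first by rewrite lee_fin.
  by rewrite mul1r.
move=> f0; apply/eqP; rewrite eq_le H// andbT.
apply: le_trans (H (- c)%R _ _) _ => //=.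
by under eq_integral do rewrite subrK.
Qed.

End one_dim.

Section dot.
Context {R : realType}.

Lemma dotvC d (u v : 'rV[R]_d) : dotv u v = dotv v u.
Proof. by apply: eq_bigr => i _; rewrite mulrC. Qed.

Lemma dotvDl d (u v w : 'rV[R]_d) : dotv (u + v) w = dotv u w + dotv v w.
Proof. by rewrite -big_split/=; apply: eq_bigr => i _; rewrite !mxE mulrDl. Qed.

Lemma dotvZl d a (u w : 'rV[R]_d) : dotv (a *: u) w = a * dotv u w.
Proof. by rewrite mulr_sumr; apply: eq_bigr => i _; rewrite !mxE mulrA. Qed.

Lemma dotvDr d (u v w : 'rV[R]_d) : dotv w (u + v) = dotv w u + dotv w v.
Proof. by rewrite dotvC dotvDl !(dotvC w). Qed.

Lemma dotvZr d a (u w : 'rV[R]_d) : dotv w (a *: u) = a * dotv w u.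
Proof. by rewrite dotvC dotvZl dotvC. Qed.

Lemma dotvNl d (u w : 'rV[R]_d) : dotv (- u) w = - dotv u w.
Proof. by rewrite -scaleN1r dotvZl mulN1r. Qed.

Lemma dotvNr d (u w : 'rV[R]_d) : dotv w (- u) = - dotv w u.
Proof. by rewrite dotvC dotvNl dotvC. Qed.

Lemma dotv_ge0 d (u : 'rV[R]_d) : 0 <= dotv u u.
Proof. by apply: sumr_ge0 => i _; rewrite -expr2 sqr_ge0. Qed.

Lemma dotv_row_mx n (s t : R) (x y : 'rV[R]_n) :
  @dotv R n.+1 (row_mx (s%:M : 'rV_1) x) (row_mx (t%:M : 'rV_1) y) =
  s * t + dotv x y.
Proof.
transitivity (\sum_(i < 1 + n) row_mx (s%:M : 'rV_1) x 0 i *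
  row_mx (t%:M : 'rV_1) y 0 i) => [//|].
rewrite big_split_ord/= big_ord1 !row_mxEl !mxE eqxx !mulr1n; congr (_ + _).
by apply: eq_bigr => i _; rewrite !row_mxEr.
Qed.

(** Here [s] is the squared radius: the section at distance t from the center is then a ball with
    parameter [s - t ^+ 2], empty when this is not positive. *)
Definition oball d (a : 'rV[R]_d) (s : R) : set 'rV[R]_d :=
  [set x | dotv (x - a) (x - a) < s].

End dot.

Section leb.
Context {R : realType}.
Local Notation mu := (@lebesgue_measure R).
Local Open Scope ereal_scope.

Lemma leb_ge0 d (A : set 'rV[R]_d) : 0 <= leb A.
Proof.
elim: d A => [|d IH] A /=; first by rewrite lee_fin.
by apply: integral_ge0 => t _; exact: IH.
Qed.

Lemma leb_mono d (A B : set 'rV[R]_d) : A `<=` B -> leb A <= leb B.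
Proof.
elim: d A B => [|d IH] A B AB /=.
  rewrite lee_fin !indicE; have [/set_mem A0|] := boolP (_ \in A).
    by rewrite mem_set//; exact: AB.
  by rewrite ler0n.
apply: ge0_integral_mono => t; first exact: leb_ge0.
by apply: IH => y; exact: AB.
Qed.

Lemma row_mxD d (t : R) (y : 'rV[R]_d) (a : 'rV[R]_(1 + d)) :
  (row_mx (t%:M : 'rV_1) y + a =
   row_mx ((t + lsubmx a 0 0)%:M : 'rV_1) (y + rsubmx a))%R.
Proof.
rewrite -[a in LHS]hsubmxK add_row_mx; congr row_mx.
by apply/rowP => i; rewrite !ord1 !mxE !mulr1n.
Qed.

Lemma leb_shift d (a : 'rV[R]_d) (A : set 'rV[R]_d) :
  leb [set x | A (x + a)%R] = leb A.
Proof.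
elim: d a A => [|d IH] a A /=.
  by congr ((\1_ _ _)%:E); apply/funext => x /=; congr (A _); apply/rowP; case.
pose f t := leb [set y : 'rV[R]_d | A (row_mx (t%:M : 'rV[R]_1) y)].
rewrite -[RHS](@integral_shift R (lsubmx (a : 'rV_(1 + d)) 0%R 0%R) f)//;
  last first.
  by move=> t; exact: leb_ge0.
apply: eq_integral => t _; rewrite /f -[RHS](IH (rsubmx (a : 'rV_(1 + d)))).
congr (leb _); apply/funext => y /=; congr (A _).
exact: row_mxD.
Qed.

End leb.

(** * Radial integrals and the recursion on the dimension *)

Section radial.
Context {R : realType}.
Local Notation mu := (@lebesgue_measure R).

(* [s] is the squared radius. *)
Definition radial_vol (d : nat) (s : R) : R :=
  if 0 < s then Num.sqrt s ^+ d else 0.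

Lemma radial_vol_ge0 d s : 0 <= radial_vol d s.
Proof.
by rewrite /radial_vol; case: ifP => // _; rewrite exprn_ge0// sqrtr_ge0.
Qed.

Lemma measurable_radial_vol d : measurable_fun setT (radial_vol d).
Proof.
apply: measurable_fun_ifT => //; first exact: measurable_fun_ltr.
apply: measurable_funX; apply: continuous_measurable_fun => x.
exact: sqrt_continuous.
Qed.

Lemma radial_volM d s t : 0 < s ->
  radial_vol d (s * t) = Num.sqrt s ^+ d * radial_vol d t.
Proof.
move=> s0; rewrite /radial_vol pmulr_rgt0//; case: ifP; last by rewrite mulr0.
by move=> t0; rewrite sqrtrM ?(ltW s0)// exprMn.
Qed.

Local Open Scope ereal_scope.

(** Base case of the recursion: [radial_vol 0] is the indicator of [0 < s], which leaves the
    exponential density of rate 1. *)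
Lemma integral_radial_vol0 :
  \int[mu]_s (radial_vol 0 s * expR (- s))%:E = 1.
Proof.
rewrite -[RHS](@integral_exponential_pdf R 1)//.
transitivity (\int[mu]_(s in `]0%R, +oo[) (expR (- s))%:E).
  rewrite [RHS]integral_mkcond; apply: eq_integral => s _.
  rewrite /patch mem_setE in_itv/= andbT /radial_vol; case: ifP => _.
    by rewrite expr0 mul1r.
  by rewrite mul0r.
rewrite integral_itv_obnd_cbnd; last first.
  by apply/measurable_EFinP; apply: measurableT_comp => //;
    exact: measurable_funTS.
rewrite [LHS]integral_mkcond; apply: eq_integral => s _.
rewrite /exponential_pdf /patch; case: ifP => // _.
by rewrite mul1r mulN1r.
Qed.

(** Volume, by slicing, of the ball of squared radius [s] in dimension d + 1, when [v] is the volume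
    of the unit ball in dimension d. *)
Definition radial_rec (v : R) d (s : R) :=
  \int[mu]_t (v * radial_vol d (s - t ^+ 2))%:E.

Let measurable_radial_section (v : R) d (u : R) :
  measurable_fun setT (fun t : R => (v * radial_vol d (u - t ^+ 2))%:E).
Proof.
apply/measurable_EFinP; apply: measurable_funM => //.
apply: measurableT_comp; first exact: measurable_radial_vol.
by apply: measurable_funB => //; exact: measurable_funX.
Qed.

(** Homogeneity: the substitution of sqrt s * t for t brings out one factor sqrt s from dt and d of
    them from the sections. *)
Lemma radial_recE (v : R) d (s : R) : (0 <= v)%R ->
  radial_rec v d s = (fine (radial_rec v d 1) * radial_vol d.+1 s)%:E.
Proof.
move=> v0.
have mf := measurable_radial_section v d.
have f0 (u t : R) : 0 <= (v * radial_vol d (u - t ^+ 2))%:E.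
  by rewrite lee_fin mulr_ge0// radial_vol_ge0.
have [s0|s0] := ltP 0%R s; last first.
  rewrite /radial_vol ltNge s0/= mulr0; apply: integral0_eq => t _.
  rewrite /radial_vol ifF ?mulr0//; apply/negbTE; rewrite -leNgt.
  by rewrite subr_le0 (le_trans s0)// sqr_ge0.
(* Finiteness makes [fine] faithful: the integrand is at most [v] and vanishes outside [-1, 1]. *)
have fin : radial_rec v d 1 \is a fin_num.
  rewrite ge0_fin_numE ?integral_ge0//.
  apply: (@le_lt_trans _ _ (\int[mu]_(t in `[(-1)%R, 1%R]) v%:E)).
    rewrite [leRHS]integral_mkcond; apply: ge0_integral_mono => //= t.
    rewrite /patch; case: ifPn; rewrite mem_setE in_itv/=.
      move=> _; rewrite lee_fin ler_piMr// /radial_vol; case: ifP => // _.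
      rewrite exprn_ile1// ?sqrtr_ge0// -[leRHS](sqrtr1) ler_wsqrtr//.
      by rewrite gerBl sqr_ge0.
    rewrite -ler_norml => t1; rewrite /radial_vol ifF ?mulr0//.
    apply/negbTE; rewrite -leNgt subr_le0 -[leLHS](expr1n _ 2)
      -[leRHS]real_normK ?num_real//.
    by rewrite lerXn2r ?nnegrE//; apply/ltW; rewrite ltNge.
  rewrite integral_cst//= lebesgue_measure_itv/=; case: ifP => _; last first.
    by rewrite mule0.
  by rewrite -EFinD -EFinM ltry.
rewrite /radial_rec (@integral_affine R (Num.sqrt s) 0) ?sqrtr_gt0//.
transitivity ((Num.sqrt s)%:E * \int[mu]_t
    ((Num.sqrt s ^+ d)%:E * (v * radial_vol d (1 - t ^+ 2))%:E)).
  congr (_ * _); apply: eq_integral => t _;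
    rewrite addr0 exprMn sqr_sqrtr ?(ltW s0)//.
  rewrite -{1}[s]mulr1 -mulrBr radial_volM// -EFinM; congr EFin; ring.
rewrite ge0_integralZl_EFin//; last exact: mf.
rewrite -/(radial_rec v d 1) -{1}(fineK fin) -!EFinM /radial_vol s0 exprS.
congr EFin; ring.
Qed.

Let measurable_radial_density (v : R) d :
  measurable_fun setT (fun s : R => (v * radial_vol d s * expR (- s))%:E).
Proof.
apply/measurable_EFinP; apply: measurable_funM; last first.
  by apply: measurableT_comp => //; exact: measurableT_comp.
by apply: measurable_funM => //; exact: measurable_radial_vol.
Qed.

(* By Tonelli, the integral of the volumes against exp(-s) is multiplied by the
   Gaussian integral sqrt pi when the dimension increases by one, which
   identifies the volume with [kappa]. *)
Lemma integral_radial_rec (v : R) d : (0 <= v)%R ->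
  \int[mu]_s (fine (radial_rec v d 1) * radial_vol d.+1 s * expR (- s))%:E =
  (Num.sqrt pi)%:E * \int[mu]_s (v * radial_vol d s * expR (- s))%:E.
Proof.
move=> v0.
pose g (s t : R) : \bar R := (v * radial_vol d (s - t ^+ 2) * expR (- s))%:E.
have mg : measurable_fun setT (fun st : R * R => g st.1 st.2).
  apply/measurable_EFinP; apply: measurable_funM; last first.
    by apply: measurableT_comp => //; exact: measurableT_comp.
  apply: measurable_funM => //.
  apply: measurableT_comp; first exact: measurable_radial_vol.
  by apply: measurable_funB => //; exact: measurable_funX.
have mg1 s : measurable_fun setT (g s).
  exact: (measurableT_comp mg (measurable_pair1 s)).
have mg2 t : measurable_fun setT (g ^~ t).
  exact: (measurableT_comp mg (measurable_pair2 t)).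
have g0 s t : 0 <= g s t.
  by rewrite lee_fin mulr_ge0 ?expR_ge0// mulr_ge0// radial_vol_ge0.
transitivity (\int[mu]_s \int[mu]_t g s t).
  apply: eq_integral => s _.
  rewrite EFinM -radial_recE// /radial_rec muleC -ge0_integralZl_EFin
    ?expR_ge0//.
  - by apply: eq_integral => t _; rewrite -EFinM mulrC.
  - by move=> t _; rewrite lee_fin mulr_ge0// radial_vol_ge0.
  - exact: measurable_radial_section.
rewrite (@fubini_tonelli _ _ (measurableTypeR R) (measurableTypeR R) R mu mu
  (fun st : R * R => g st.1 st.2))//=.
transitivity (\int[mu]_t ((gauss_fun t)%:E *
    \int[mu]_s (v * radial_vol d s * expR (- s))%:E)).
  apply: eq_integral => t _.
  (* Shifting s by t^2 turns exp(-s) into exp(-s) exp(-t^2), so the double integral factors. *)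
  rewrite -[LHS](integral_shift (t ^+ 2)%R)//.
  rewrite -ge0_integralZl_EFin ?expR_ge0//; last 2 first.
  - by move=> s _; rewrite lee_fin mulr_ge0 ?expR_ge0// mulr_ge0//
    radial_vol_ge0.
  - exact: measurable_radial_density.
  apply: eq_integral => s _; rewrite /g addrK -EFinM opprD expRD /gauss_fun.
  congr EFin; ring.
have I0 : 0 <= \int[mu]_s (v * radial_vol d s * expR (- s))%:E.
  by apply: integral_ge0 => s _;
    rewrite lee_fin mulr_ge0 ?expR_ge0// mulr_ge0// radial_vol_ge0.
under eq_integral do rewrite muleC.
rewrite ge0_integralZl//; last 2 first.
- by apply/measurable_EFinP; exact: measurable_gauss_fun.
- by move=> t _; rewrite lee_fin gauss_fun_ge0.
by rewrite integralT_gauss muleC.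
Qed.

End radial.

Section ball_volume.
Context {R : realType}.
Local Notation mu := (@lebesgue_measure R).
Local Open Scope ereal_scope.

(** Induction on d by slicing. The second identity pins down the constant [v], which the first
    leaves unknown. *)
Lemma leb_oball_radial d : exists2 v : R, (0 <= v)%R &
  (forall (a : 'rV[R]_d) s, leb (oball a s) = (v * radial_vol d s)%:E) /\
  \int[mu]_s (v * radial_vol d s * expR (- s))%:E = (Num.sqrt pi ^+ d)%:E.
Proof.
elim: d => [|d [v v0 [vE vI]]].
  exists 1%R => //; split=> [a s|]; last first.
    by under eq_integral do rewrite mul1r; rewrite expr0 integral_radial_vol0.
  rewrite mul1r /= indicE /oball/radial_vol.
  congr (_%:E); case: ifPn => s0; first by rewrite mem_set//= /dotv big_ord0.
  by rewrite memNset//= /dotv big_ord0; exact/negP.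
exists (fine (radial_rec v d 1)).
  by apply/fine_ge0/integral_ge0 => t _;
    rewrite lee_fin mulr_ge0// radial_vol_ge0.
split=> [a s|]; last first.
  by rewrite integral_radial_rec// vI -EFinM exprS.
rewrite -radial_recE// /radial_rec /=.
rewrite -(@integral_shift R (- lsubmx (a : 'rV_(1 + d)) 0 0)%R
  (fun t => (v * radial_vol d (s - t ^+ 2))%:E)); last first.
  by move=> t; rewrite lee_fin mulr_ge0// radial_vol_ge0.
apply: eq_integral => t _; rewrite -(vE (rsubmx (a : 'rV_(1 + d)))).
congr (leb _); apply/funext => y; rewrite /oball/=.
have -> : (row_mx (t%:M : 'rV_1) y - a =
    row_mx ((t - lsubmx (a : 'rV_(1 + d)) 0 0)%:M : 'rV_1)
      (y - rsubmx (a : 'rV_(1 + d))) :> 'rV_d.+1)%R.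
  have := row_mxD t y (- a : 'rV_(1 + d))%R.
  by rewrite !linearN/= mxE.
by rewrite dotv_row_mx -expr2 ltrBrDl.
Qed.

Lemma integral_radial_vol_Gamma (v : R) d : (0 <= v)%R ->
  \int[mu]_s (v * radial_vol d s * expR (- s))%:E =
  v%:E * \int[mu]_(t in `]0%R, +oo[) (t `^ (1 + d%:R / 2 - 1) * expR (- t))%:E.
Proof.
move=> v0.
rewrite [in RHS]integral_mkcond -ge0_integralZl_EFin//; last 2 first.
- by move=> t _; rewrite /patch; case: ifP => // _;
  rewrite lee_fin mulr_ge0 ?powR_ge0 ?expR_ge0.
- apply/(measurable_restrictT _ _).1 => //; apply: measurable_funTS.
  apply/measurable_EFinP; apply: measurable_funM; first exact: measurable_powR.
  by apply: measurableT_comp => //; exact: measurableT_comp.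
apply: eq_integral => s _; rewrite /patch mem_setE in_itv/= andbT /radial_vol.
case: ifP => s0; last by rewrite mulr0 mul0r mule0.
rewrite -EFinM -mulrA; congr (_ * (_ * _))%:E.
rewrite addrAC subrr add0r mulrC powRrM powR12_sqrt ?(ltW s0)//.
by rewrite powR_mulrn// sqrtr_ge0.
Qed.

(** Two evaluations of the same integral are compared: v Gamma(1 + d/2) = pi^(d/2). *)
Let kappa_leb_oball d : (0 < kappa R d)%R /\
  forall (a : 'rV[R]_d) s, leb (oball a s) = (kappa R d * radial_vol d s)%:E.
Proof.
have [v v0 [vE vI]] := leb_oball_radial d.
have pi0 : (0 < Num.sqrt (pi : R))%R by rewrite sqrtr_gt0 pi_gt0.
have pid : (0 < Num.sqrt (pi : R) ^+ d)%R by rewrite exprn_gt0.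
rewrite integral_radial_vol_Gamma// in vI.
have vn0 : (0 < v)%R.
  rewrite lt_neqAle v0 andbT; apply/eqP => v00; move: vI; rewrite -v00 mul0e.
  by case=> /esym/eqP; rewrite gt_eqF.
suff -> : kappa R d = v by [].
rewrite /kappa /Gamma /Rintegral.
move: vI; set I := integral _ _ _ => vI.
(* [Gamma] takes [fine] of this integral; it is finite since its product with [v > 0] is. *)
have Ifin : I \is a fin_num.
  have : v%:E * I \is a fin_num by rewrite vI.
  move: vn0; case: I {vI} => [//| |] vn0;
    by rewrite ?gt0_muley ?gt0_muleNy ?lte_fin.
move: vI; rewrite -(fineK Ifin) -EFinM => -[vI].
rewrite [(d%:R / 2)%R]mulrC powRrM powR12_sqrt ?pi_ge0//.
rewrite powR_mulrn ?(ltW pi0)// -vI mulfK//.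
by apply: contraTneq pid => I0; rewrite -vI I0 mulr0 ltxx.
Qed.

Lemma kappa_gt0 d : (0 < kappa R d)%R.
Proof. exact: (kappa_leb_oball d).1. Qed.

Lemma leb_oball d (a : 'rV[R]_d) s :
  leb (oball a s) = (kappa R d * radial_vol d s)%:E.
Proof. exact: (kappa_leb_oball d).2. Qed.

End ball_volume.

(** * Void probabilities *)

Section borel.
Context {R : realType} {d : nat}.
Implicit Types (A B : set 'rV[R]_d) (u : 'rV[R]_d).

Let bT := g_sigma_algebraType [set A : set 'rV[R]_d | open A].

Lemma borel_open A : open A -> borel A.
Proof. by move=> oA; exact: sub_sigma_algebra. Qed.

Lemma borelC A : borel A -> borel (~` A).
Proof. by move=> bA; exact: (@measurableC _ bT). Qed.

Lemma borelI A B : borel A -> borel B -> borel (A `&` B).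
Proof. by move=> bA bB; exact: (@measurableI _ bT). Qed.

Lemma borel_bigcup n (F : 'I_n -> set 'rV[R]_d) :
  (forall i, borel (F i)) -> borel (\bigcup_i F i).
Proof.
move=> bF; apply: (@fin_bigcup_measurable _ bT) => [|i _]; last exact: bF.
exact: finite_finset.
Qed.

Lemma continuous_dotv (f g : 'rV[R]_d -> 'rV[R]_d) :
  continuous f -> continuous g -> continuous (fun x => dotv (f x) (g x)).
Proof.
move=> cf cg; rewrite /dotv.
apply: continuous_big => [|i _ x]; first exact: add_continuous.
exact: (cvgM (continuous_comp (cf x) (@coord_continuous R 1 d 0 i (f x)))
             (continuous_comp (cg x) (@coord_continuous R 1 d 0 i (g x)))).
Qed.

Let continuous_cstv u : continuous (fun _ : 'rV[R]_d => u).
Proof. exact: cst_continuous. Qed.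

Let continuous_idv : continuous (fun x : 'rV[R]_d => x).
Proof. by move=> x; apply: (@cvg_id _ (nbhs x)). Qed.

Let continuous_subv u : continuous (fun x : 'rV[R]_d => x - u).
Proof.
by move=> x; apply: continuousB; [exact: continuous_idv|exact: continuous_cstv].
Qed.

Lemma borel_dotv_lt u a : borel [set x | dotv u x < a].
Proof.
apply: borel_open; apply: (@open_comp _ _ (dotv u) [set y | y < a]);
  last exact: open_lt.
by move=> x _; apply: (@continuous_dotv _ _ (@continuous_cstv u)
  (@continuous_idv)).
Qed.

Lemma borel_dotv_ge u a : borel [set x | a <= dotv u x].
Proof.
rewrite (_ : mkset _ = ~` [set x | dotv u x < a]).
  by apply: borelC; exact: borel_dotv_lt.
by apply/seteqP; split => x /=; rewrite leNgt => /negP.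
Qed.

Lemma borel_dotv_gt u a : borel [set x | a < dotv u x].
Proof.
rewrite (_ : mkset _ = [set x | dotv (- u) x < - a]);
  first exact: borel_dotv_lt.
by apply/seteqP; split => x /=; rewrite dotvNl ltrN2.
Qed.

Lemma borel_oball u s : borel (oball u s).
Proof.
apply: borel_open.
apply: (@open_comp _ _ (fun x : 'rV[R]_d => dotv (x - u) (x - u))
  [set y | y < s]); last exact: open_lt.
by move=> x _; exact: (@continuous_dotv _ _ (@continuous_subv u)
  (@continuous_subv u)).
Qed.

Lemma enorm_le1 u : (enorm u <= 1) = (dotv u u <= 1).
Proof. by rewrite /enorm -{1}[1](@sqrtr1 R) ler_sqrt. Qed.

Lemma borel_eball1 : borel (@eball R d 1).
Proof.
rewrite (_ : @eball R d 1 = ~` [set x | 1 < dotv x x]).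
  apply: borelC; apply: borel_open.
  apply: (@open_comp _ _ (fun x : 'rV[R]_d => dotv x x) [set y | 1 < y]);
    last exact: open_gt.
  by move=> x _; exact: (@continuous_dotv _ _ (@continuous_idv)
    (@continuous_idv)).
by apply/seteqP; split => x /=; rewrite /eball/= enorm_le1 leNgt => /negP.
Qed.

End borel.

Definition void (T : Type) (R : realType) d (X : T -> set 'rV[R]_d) B : set T :=
  [set w | X w `&` B = set0].

Section void.
Context {R : realType} {dT : measure_display} {T : measurableType dT}.
Context {P : probability T R} {d : nat} {lambda : R} {X : T -> set 'rV[R]_d}.
Hypothesis lambda0 : 0 < lambda.
Hypothesis pp : poisson_process P lambda X.
Implicit Types B : set 'rV[R]_d.
Local Open Scope ereal_scope.

Lemma voidE B : void X B = npoints X B @^-1` [set 0].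
Proof.
apply/seteqP; split => w /=; rewrite /void/= /npoints.
  by move=> ->; rewrite /counting asboolT ?fset_set0 ?cardfs0//;
    exact: finite_set0.
rewrite /counting; case: asboolP => [fin|_] //.
move/eqP; rewrite eqe pnatr_eq0 finmap.cardfs_eq0 => /eqP h.
apply/seteqP; split => x // /mem_set.
by rewrite -in_fset_set// h finmap.in_fset0.
Qed.

Lemma measurable_void B : borel B -> measurable (void X B).
Proof.
move=> bB; rewrite voidE -[X in measurable X]setTI.
by apply: (pp_measurable pp bB) => //; exact: emeasurable_set1.
Qed.

Lemma prob_void B : borel B -> leb B < +oo ->
  P (void X B) = (expR (- (lambda * fine (leb B))))%:E.
Proof.
move=> bB fB; rewrite voidE; transitivity (P [set w | npoints X B w = 0%:R%:E]).
  by congr (P _).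
rewrite (pp_poisson pp bB fB 0) /poisson_prob; case: ifPn => h.
  rewrite esum_set1 /poisson_pmf ?h.
    by rewrite expr0 fact0 invr1 mulr1 mul1r.
  by rewrite lee_fin mulr_ge0// ?expR_ge0// expr0 fact0 invr1 mulr1.
(* For a null set the rate is 0, where the Poisson law is a Dirac mass; it gives {0} the mass 1 =
   exp 0. *)
have : (0 <= lambda * fine (leb B))%R
  by rewrite mulr_ge0 ?(ltW lambda0)// fine_ge0// leb_ge0.
rewrite le_eqVlt (negbTE h) orbF => /eqP <-.
by rewrite oppr0 expR0 diracE mem_set.
Qed.

Lemma prob_hit_le B : borel B -> leb B < +oo ->
  P (~` void X B) <= (lambda * fine (leb B))%:E.
Proof.
move=> bB fB; rewrite probability_setC; last exact: measurable_void.
rewrite prob_void// -EFinD lee_fin.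
have := expR_ge1Dx (- (lambda * fine (leb B)))%R; lra.
Qed.

(* Void probabilities are multiplicative over disjoint sets, so the additivity
   of [leb] comes for free from the existence of the process. *)
Lemma leb_bigcup n (B : 'I_n -> set 'rV[R]_d) : (forall i, borel (B i)) ->
  trivIset setT B -> leb (\bigcup_i B i) < +oo ->
  fine (leb (\bigcup_i B i)) = (\sum_(i < n) fine (leb (B i)))%R.
Proof.
move=> bB tB fB.
have fBi i : leb (B i) < +oo.
  by apply: le_lt_trans fB; apply: leb_mono; exact: bigcup_sup.
have := pp_independent pp bB tB (A := fun=> [set 0]) (fun=> emeasurable_set1 _).
have -> : \bigcap_(i in [set: 'I_n]) (npoints X (B i) @^-1` [set 0]) =
    void X (\bigcup_i B i).
  under eq_bigcapr do rewrite -voidE.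
  apply/seteqP; split => w /= h.
    rewrite /void/= -subset0 => x [Xx [i _ Bx]].
    by have := h i I; rewrite /void/= -subset0 => /(_ x); apply.
  move=> i _; rewrite /void/= -subset0 => x [Xx Bx].
  by move: h; rewrite /void/= -subset0 => /(_ x); apply; split => //; exists i.
rewrite prob_void//; last exact: borel_bigcup.
under eq_bigr do rewrite -voidE prob_void//.
rewrite prodEFin => -[]; rewrite -expR_sum => /expR_inj.
rewrite sumrN -mulr_sumr => /oppr_inj/mulfI -> //.
by rewrite gt_eqF.
Qed.

End void.

(** * Spherical caps *)

Section caps.
Context {R : realType} {d : nat}.
Implicit Types (u x y : 'rV[R]_d) (a : R).

(** Closed caps serve to bound the support function from below; void open caps are exactly the
    events that it is at most [a]. *)
Definition cap u a : set 'rV[R]_d := eball d 1 `&` [set x | a <= dotv u x].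

Definition ocap u a : set 'rV[R]_d := eball d 1 `&` [set x | a < dotv u x].

Lemma borel_cap u a : borel (cap u a).
Proof. by apply: borelI; [exact: borel_eball1|exact: borel_dotv_ge]. Qed.

Lemma borel_ocap u a : borel (ocap u a).
Proof. by apply: borelI; [exact: borel_eball1|exact: borel_dotv_gt]. Qed.

Lemma leb_oball_lty u a : (leb (oball u a) < +oo)%E.
Proof. by rewrite leb_oball ltry. Qed.

Lemma leb_sub_eball1_lty (A : set 'rV[R]_d) : A `<=` eball d 1 ->
  (leb A < +oo)%E.
Proof.
move=> A1; apply: le_lt_trans (leb_oball_lty 0 2); apply: leb_mono => x /A1.
rewrite /eball/= enorm_le1 /oball/= subr0; lra.
Qed.

Lemma dotv_subZ u x c : dotv u u = 1 ->
  dotv (x - c *: u) (x - c *: u) = dotv x x - 2 * c * dotv u x + c ^+ 2.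
Proof.
move=> u1; rewrite !(dotvDl, dotvDr, dotvNl, dotvNr, dotvZl, dotvZr) u1.
by rewrite (dotvC x u); ring.
Qed.

Lemma sqr_dotv_le u x : dotv u u = 1 -> dotv u x ^+ 2 <= dotv x x.
Proof.
by move=> u1; have := dotv_ge0 (x - dotv u x *: u); rewrite dotv_subZ//; nra.
Qed.

Lemma dotv_esphere u : esphere R d u -> dotv u u = 1.
Proof.
rewrite /esphere/= /enorm => /(congr1 (fun t => t ^+ 2)).
by rewrite sqr_sqrtr ?dotv_ge0// expr1n.
Qed.

(** On the cap, |x - a u|^2 = |x|^2 - 2 a <u, x> + a^2 < 1 - a^2. *)
Lemma leb_ocap_le u a : dotv u u = 1 -> 0 < a ->
  (leb (ocap u a) <= (kappa R d * radial_vol d (1 - a ^+ 2))%:E)%E.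
Proof.
move=> u1 a0; rewrite -(leb_oball (a *: u)).
apply: leb_mono => x []; rewrite /eball/oball/= enorm_le1 => x1 ax.
rewrite dotv_subZ//; nra.
Qed.

Section lower.
Context {dT : measure_display} {T : measurableType dT}.
Context {P : probability T R} {lambda : R} {X : T -> set 'rV[R]_d}.
Hypothesis lambda0 : 0 < lambda.
Hypothesis pp : poisson_process P lambda X.

(* The slabs [slab j] cut a ball of center [c *: u]; moving any of them along
   [u] into the central slab brings its points closer to the center. *)
Lemma leb_cap_ge u a (tau : R) : dotv u u = 1 -> 0 <= a -> 0 < tau ->
  tau <= 1 ->
  kappa R d * radial_vol d (1 - (a + 2 * tau) ^+ 2) * (tau / 4) <=
  fine (leb (cap u a)).
Proof.
(* The heights within [tau] of the center [c] start at [a], and s = 1 - (c + tau)^2 leaves room for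
   the translated slabs inside the unit ball. *)
move=> u1 a0 t0 t1; pose c := a + tau; pose s := 1 - (a + 2 * tau) ^+ 2.
have s1 : s <= 1 by rewrite /s gerBl sqr_ge0.
pose D := oball (c *: u) s.
(* The 2 K slabs of width [tau] cover the heights within 1 of [c], and K tau <= 2 bounds their
   number by 4 / tau, whence the factor tau / 4. *)
pose K := (Num.truncn tau^-1).+1.
have tV0 : 0 < tau^-1 by rewrite invr_gt0.
have K1 : 1 < K%:R * tau.
  by rewrite -ltr_pdivrMr// mul1r truncnS_gt.
have K2 : K%:R * tau <= 2.
  have : (Num.truncn tau^-1)%:R <= tau^-1 by rewrite truncn_le (ltW tV0).
  by rewrite -(ler_pM2r t0) mulVf ?gt_eqF// /K -natr1 mulrDl mul1r; lra.
pose l (j : 'I_(K + K)) : R := (j%:R - K%:R) * tau.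
pose slab j := (D `&` [set x | c + l j <= dotv u x]) `&`
  [set x | dotv u x < c + l j + tau].
have uc : dotv u (c *: u) = c by rewrite dotvZr u1 mulr1.
(* Here U = <u, x>, V = |x|^2, [e] is the height of the center and [sg] the shift. The hypotheses
   say that the shift does not increase the distance to the center and leaves the point at most [t]
   above it. *)
have sqnorm_le1 (U V sg e t s' : R) : V - 2 * e * U + e ^+ 2 < s' ->
    sg * (sg - 2 * (U - e)) <= 0 -> 0 <= e * (t - (U - e - sg)) ->
    s' = 1 - (e + t) ^+ 2 -> V - 2 * sg * U + sg ^+ 2 <= 1.
  by move=> h1 h2 h3 h4; have := sqr_ge0 t; rewrite h4 in h1; lra.
have sub_slab j : exists v, slab j `<=` [set x | cap u a (x + v)].
  (* The face of the slab nearest to the center is moved onto the height [c]: the lower face for the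
     slabs above, the upper face for those below. *)
  pose sigma : R := if (K <= j)%N then l j else l j + tau.
  exists (- (sigma *: u)) => x [[]]; rewrite /D/oball/= dotv_subZ// => Dx lx xl.
  have [p1 p2 p3] : [/\ - tau <= dotv u x - c - sigma,
      dotv u x - c - sigma <= tau & sigma * (sigma - 2 * (dotv u x - c)) <= 0].
    rewrite /sigma; case: ifPn => Kj.
      have : 0 <= l j by rewrite mulr_ge0 ?(ltW t0)// subr_ge0 ler_nat.
      by move=> l0; split; nra.
    have : l j + tau <= 0.
      rewrite -[X in _ + X]mul1r -mulrDl pmulr_lle0// addrAC subr_le0 natr1
        ler_nat.
      by rewrite ltnNge.
    by move=> l0; split; nra.
  split; rewrite /=.
    rewrite /eball/= enorm_le1 dotv_subZ//.
    have c0 : 0 <= c by rewrite /c; lra.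
    have cp : 0 <= c * (tau - (dotv u x - c - sigma))
      by rewrite mulr_ge0// subr_ge0.
    have cE : a + 2 * tau = c + tau by rewrite /c; ring.
    by apply: (sqnorm_le1 _ _ _ _ _ _ Dx p3 cp); rewrite -cE.
  rewrite dotvDr dotvNr dotvZr u1 mulr1; move: p1; rewrite /c; lra.
have slab_lty j : (leb (slab j) < +oo)%E.
  by apply: le_lt_trans (leb_oball_lty (c *: u) s); apply: leb_mono => x [[]].
have slab_le j : fine (leb (slab j)) <= fine (leb (cap u a)).
  have [v vj] := sub_slab j.
  apply: fine_le; rewrite ?ge0_fin_numE ?leb_ge0//.
    by apply: leb_sub_eball1_lty => x [].
  by rewrite -(leb_shift v (cap u a)); exact: leb_mono.
(* As [s <= 1], heights in [D] differ from [c] by less than 1; in units of [tau] and offset by [K],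
   their integer part is the index of the slab. *)
have DU : D = \bigcup_j slab j.
  apply/seteqP; split => [x Dx|x [j _ [[]]]//].
  have p1 : (dotv u x - c) ^+ 2 < 1.
    rewrite -[c]uc -dotvNr -dotvDr; apply: le_lt_trans (sqr_dotv_le _ u1) _.
    by move: Dx; rewrite /D/oball/=; lra.
  pose q := (dotv u x - c) / tau + K%:R.
  have pq : dotv u x - c = (q - K%:R) * tau by rewrite /q addrK divfK// gt_eqF.
  have /andP[p2 p3] : - 1 < dotv u x - c < 1.
    by rewrite -ltr_norml -sqrtr_sqr -(@sqrtr1 R) ltr_sqrt.
  have qE : q = (dotv u x - c + K%:R * tau) / tau.
    by rewrite /q [RHS]mulrDl mulfK// gt_eqF.
  have q0 : 0 <= q by rewrite qE divr_ge0 ?(ltW t0)//; lra.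
  have q2 : q < (K + K)%:R by rewrite qE ltr_pdivrMr// natrD mulrDl; lra.
  have /andP[qj jq] := truncn_itv q0.
  have jK : (Num.truncn q < K + K)%N by rewrite truncn_lt_nat.
  exists (Ordinal jK) => //; rewrite /slab/l/=; split; [split => //=|].
    rewrite -lerBrDl pq ler_pM2r// lerD2r//.
  rewrite -addrA -ltrBlDl pq -[X in _ < _ + X]mul1r -mulrDl ltr_pM2r//.
  by rewrite -natr1 in jq; lra.
have bslab j : borel (slab j).
  by apply: borelI (borel_dotv_lt _ _); apply: borelI (borel_dotv_ge _ _);
    exact: borel_oball.
have tslab : trivIset setT slab.
  have H (i j : 'I_(K + K)) x : (i < j)%N -> slab i x -> slab j x -> False.
    move=> ij [_ /= xi] [[_ /= jx] _].
    have : l i + tau <= l j.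
      rewrite /l -[X in _ + X]mul1r -mulrDl ler_pM2r// addrAC lerD2r natr1
        ler_nat//.
    by move=> ?; lra.
  move=> i j _ _ [x [ix jx]]; apply/val_inj/eqP; case: (ltngtP i j) => // ij.
    by case: (H _ _ _ ij ix jx).
  by case: (H _ _ _ ij jx ix).
have := leb_bigcup lambda0 pp bslab tslab.
rewrite -DU => /(_ (leb_oball_lty _ _)).
rewrite /D leb_oball [fine _]/= => ->.
have : \sum_(j < K + K) fine (leb (slab j)) <=
    (K + K)%:R * fine (leb (cap u a)).
  rewrite mulr_natl -[X in _ <= _ *+ X]card_ord -sumr_const.
  by apply: ler_sum => j _; exact: slab_le.
have c0 : 0 <= fine (leb (cap u a)) by rewrite fine_ge0// leb_ge0.
by rewrite natrD; nra.
Qed.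

End lower.
End caps.

(** * The minimal support function *)

Section support.
Context {R : realType} {T : Type} {d : nat} (X : T -> set 'rV[R]_d).
Implicit Types (u v x : 'rV[R]_d) (a e : R) (w : T).

(** A form of Cauchy-Schwarz: for z = u - v, expanding |z - e x|^2 >= 0 gives 2 e <z, x> <= 2
    e^2. *)
Lemma dotv_le_close u v x e : 0 < e -> dotv (u - v) (u - v) <= e ^+ 2 ->
  dotv x x <= 1 -> dotv u x <= dotv v x + e.
Proof.
move=> e0 uv x1.
have -> : dotv u x = dotv v x + dotv (u - v) x by rewrite -dotvDl addrC subrK.
rewrite lerD2l; move: (u - v) uv => z zz; have := dotv_ge0 (z - e *: x).
rewrite !(dotvDl, dotvDr, dotvNl, dotvNr, dotvZl, dotvZr) (dotvC x z) => H.
rewrite -(@ler_pM2l _ (2 * e)) ?mulr_gt0//.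
have : e ^+ 2 * dotv x x <= e ^+ 2 by rewrite ler_piMr// sqr_ge0.
lra.
Qed.

Lemma convex_halfspace u a :
  convex_set ([set x | dotv u x <= a] : set (convex_lmodType 'rV[R]_d)).
Proof.
apply/convex_setW => x y /set_mem/= xa /set_mem/= ya k k0 k1.
apply/mem_set => /=; rewrite /conv/= dotvDr !dotvZr.
have : 0 <= k%:num by exact: ltW.
have : k%:num <= 1 by exact: ltW.
rewrite /unstable.onem; nra.
Qed.

(** A half-space is convex, hence contains the hull as soon as it contains the points. The empty
    body is covered, its supremum being -oo. *)
Lemma support_leP u a w :
  (support_function (ball_polytope X w) u <= a%:E)%E <-> void X (ocap u a) w.
Proof.
rewrite /void /= -subset0; split=> [H x [Xx [x1 /= ax]]|H].
  suff : (a%:E < a%:E)%E by rewrite ltxx.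
  apply: lt_le_trans H; apply: (@lt_le_trans _ _ (dotv u x)%:E);
    first by rewrite lte_fin.
  by apply: ereal_sup_ubound; exists x => // C [cC]; apply.
apply: ge_ereal_sup => _ [x Kx <-]; rewrite lee_fin.
apply: (Kx [set x | dotv u x <= a]); split; first exact: convex_halfspace.
move=> y [Xy y1] /=; rewrite leNgt; apply/negP => ay.
by apply: (H y).
Qed.

Lemma support_ge_cap u a w x : X w x -> cap u a x ->
  (a%:E <= support_function (ball_polytope X w) u)%E.
Proof.
move=> Xx [x1 ax]; apply: (@le_trans _ _ (dotv u x)%:E);
  first by rewrite lee_fin.
by apply: ereal_sup_ubound; exists x => // C [cC]; apply.
Qed.

(* One point of [A] is picked in each cell of a grid that meets [A]; the net
   thus stays inside [A], and its size is bounded by the number of cells. *)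
Lemma sphere_net (A : set 'rV[R]_d) (e : R) : 0 < e -> A `<=` esphere R d ->
  exists s : seq 'rV[R]_d,
  [/\ (size s <= (2 * (Num.truncn (d%:R / e)).+1).+1 ^ d)%N,
    forall v, v \in s -> A v &
    forall u, A u -> exists2 v, v \in s & dotv (u - v) (u - v) <= e ^+ 2].
Proof.
(* Cells have side 1 / k: two points of one cell are at squared distance at most d / k^2 <= (d /
   k)^2 <= e^2. *)
move=> e0 A1; pose k := (Num.truncn (d%:R / e)).+1.
have ke : d%:R < k%:R * e by rewrite -ltr_pdivrMr// truncnS_gt.
have k0 : 0 < k%:R :> R by rewrite ltr0n.
have coord u i : A u -> - 1 <= u 0 i <= 1.
  move=> /A1 /dotv_esphere u1.
  rewrite -ler_norml -sqrtr_sqr -(@sqrtr1 R) ler_sqrt// -u1 /dotv (bigD1 i)//=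
    -expr2 lerDl.
  by apply: sumr_ge0 => j _; rewrite -expr2 sqr_ge0.
(* The extra index 2 k is reached by coordinates equal to 1. *)
pose cell u : {ffun 'I_d -> 'I_(2 * k).+1} :=
  [ffun i => inord (Num.truncn ((u 0 i + 1) * k%:R))].
have cellE u i : A u -> (cell u i)%:R <= (u 0 i + 1) * k%:R < (cell u i)%:R + 1.
  move=> Au; have /andP[u1 u2] := coord u i Au.
  have p0 : 0 <= (u 0 i + 1) * k%:R by rewrite mulr_ge0 ?(ltW k0)//; lra.
  rewrite /cell ffunE inordK ?natr1 ?truncn_itv// truncn_lt_nat// -natr1 natrM;
    nra.
(* The default 0 never enters the net, as [s] keeps only the cells that meet [A]. *)
pose rep c := xget 0 [set u | A u /\ cell u = c].
pose s := [seq rep c | c <- enum {ffun 'I_d -> 'I_(2 * k).+1} &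
  `[< exists u, A u /\ cell u = c >]].
have repP c : (exists u, A u /\ cell u = c) -> A (rep c) /\ cell (rep c) = c.
  case=> u Hu.
  exact: (@xgetPex _ 0 [set u | A u /\ cell u = c] (ex_intro _ u Hu)).
exists s; split.
- rewrite size_map size_filter (leq_trans (count_size _ _))// -cardE card_ffun.
  by rewrite !card_ord.
- move=> v /mapP[c]; rewrite mem_filter => /andP[/asboolP/repP[? _] _] ->//.
- move=> u Au; have [Ar cr] : A (rep (cell u)) /\ cell (rep (cell u)) = cell u.
    by apply: repP; exists u.
  exists (rep (cell u)).
    apply/mapP; exists (cell u) => //; rewrite mem_filter mem_enum andbT.
    by apply/asboolP; exists u.
  set v := rep _ in Ar cr *.
  have : dotv (u - v) (u - v) * k%:R ^+ 2 <= d%:R.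
    have -> : d%:R = \sum_(i < d) (1 : R) by rewrite sumr_const card_ord.
    rewrite /dotv mulr_suml.
    apply: ler_sum => i _; rewrite !mxE.
    have := cellE u i Au; have := cellE v i Ar;
      rewrite cr => /andP[v1 v2] /andP[u1 u2].
    have : -1 <= (u 0 i - v 0 i) * k%:R <= 1 by apply/andP; split; lra.
    by case/andP; nra.
  have dd : d%:R <= d%:R ^+ 2 :> R by rewrite -natrX ler_nat;
    case: (d) => // n; rewrite -mulnn leq_pmulr.
  move=> H; rewrite -(@ler_pM2r _ (k%:R ^+ 2)) ?exprn_gt0// (le_trans H)//
    -exprMn mulrC.
  by rewrite (le_trans dd)// lerXn2r// ?nnegrE ?ler0n// ?(ltW ke)// mulr_ge0//
    ltW.
Qed.

End support.

Section bigcup_seq.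
Context {R : realType} {dT : measure_display} {T : measurableType dT}.
Context {P : probability T R} {I : eqType}.

Lemma measurable_bigcup_seq (s : seq I) (F : I -> set T) :
  (forall v, measurable (F v)) -> measurable (\bigcup_(v in [set` s]) F v).
Proof. by move=> mF; apply: fin_bigcup_measurable => // *; exact: mF. Qed.

Lemma prob_bigcup_seq_le (s : seq I) (F : I -> set T) (p : R) :
  (forall v, measurable (F v)) -> (forall v, v \in s -> P (F v) <= p%:E)%E ->
  (P (\bigcup_(v in [set` s]) F v) <= ((size s)%:R * p)%:E)%E.
Proof.
move=> mF; elim: s => [|v s IH] H.
  by rewrite (_ : [set` [::]] = set0) ?bigcup_set0 ?measure0 ?mul0r//;
    apply/seteqP; split.
have -> : \bigcup_(x in [set` v :: s]) F x =
    F v `|` \bigcup_(x in [set` s]) F x.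
  apply/seteqP; split => w /=.
    by case=> x /=; rewrite inE => /predU1P[->|xs] Fx; [left|right; exists x].
  case=> [Fv|[x xs Fx]]; first by exists v => //; exact: mem_head.
  by exists x => //; apply: mem_behead.
apply: le_trans (measureU2 _ _ _) _ => //; first exact: measurable_bigcup_seq.
rewrite /= -natr1 mulrDl mul1r addrC EFinD leeD// ?H ?mem_head// IH// => x xs.
by rewrite H// inE xs orbT.
Qed.

End bigcup_seq.

(** * Infimum of the support function over a set of directions *)

Section inf_support.
Context {R : realType} {dT : measure_display} {T : measurableType dT}.
Context {P : probability T R} {d : nat} {lambda : R} {X : T -> set 'rV[R]_d}.
Hypothesis lambda0 : 0 < lambda.
Hypothesis pp : poisson_process P lambda X.
Variable A : set 'rV[R]_d.
Hypothesis A1 : A `<=` esphere R d.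

Let h w : \bar R :=
  ereal_inf [set support_function (ball_polytope X w) u | u in A].

Let dotA u : A u -> dotv u u = 1.
Proof. by move=> /A1 /dotv_esphere. Qed.

Lemma inf_support_ltP w (a : \bar R) : (h w < a)%E <->
  exists2 u, A u & (support_function (ball_polytope X w) u < a)%E.
Proof.
split=> [/ereal_inf_lt[_ [u Au <-] ua]|[u Au]]; first by exists u.
by apply: le_lt_trans; apply: ereal_inf_lbound; exists u.
Qed.

(** A strict inequality leaves room to replace the direction by a point of a fine enough net, so
    countably many void events suffice. *)
Lemma measurable_inf_support_lt (b : R) : measurable [set w | (h w < b%:E)%E].
Proof.
have n0 n : 0 < n.+1%:R^-1 :> R by rewrite invr_gt0.
have /choice[s sP] : forall n, exists s : seq 'rV[R]_d,
    (forall v, v \in s -> A v) /\ forall u, A u ->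
    exists2 v, v \in s & dotv (u - v) (u - v) <= (n.+1%:R^-1) ^+ 2.
  by move=> n; have [s [_ s1 s2]] := sphere_net (n0 n) A1; exists s.
rewrite (_ : mkset _ = \bigcup_n \bigcup_(v in [set` s n])
    void X (ocap v (b - n.+1%:R^-1))); last first.
  apply/seteqP; split => w /=.
    move=> /inf_support_ltP[u Au ub].
    (* Of the margin 2 / (n + 1), one half pays for the net and the other keeps the inequality
       strict. *)
    have [n un] : exists n, (support_function (ball_polytope X w) u <=
        (b - 2 * n.+1%:R^-1)%:E)%E.
      case: (support_function _ _) ub => [r| |] //=; last first.
        by exists 0%N; rewrite leNye.
      rewrite lte_fin => rb; have e0 : 0 < (b - r) / 2
        by rewrite divr_gt0// subr_gt0.
      exists (Num.truncn ((b - r) / 2)^-1); rewrite lee_fin.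
      have := truncnS_gt ((b - r) / 2)^-1;
        rewrite -ltf_pV2 ?posrE ?invr_gt0 ?ltr0n// invrK.
      by set N := Num.truncn _; move: (N.+1%:R^-1) => y; lra.
    have [v vs uv] := (sP n).2 u Au; exists n => //; exists v => //.
    move/support_leP : un; rewrite /void/= -!subset0 => un x [Xx [x1 /= vx]].
    apply: (un x); split => //; split => //=.
    have := @dotv_le_close R d v u x _ (n0 n); rewrite -enorm_le1.
    rewrite -opprB dotvNl dotvNr opprK => /(_ uv x1); move: vx;
      set y := (n.+1%:R^-1); lra.
  move=> [n _ [v vs]] /support_leP vb; apply/inf_support_ltP; exists v;
    first exact: (sP n).1.
  by apply: le_lt_trans vb _; rewrite lte_fin gtrBl.
apply: bigcupT_measurable => n; apply: measurable_bigcup_seq => v.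
apply: (measurable_void pp); exact: borel_ocap.
Qed.

Lemma measurable_inf_support_gt (b : R) : measurable [set w | (b%:E < h w)%E].
Proof.
rewrite (_ : mkset _ = ~` \bigcap_n [set w | (h w < (b + n.+1%:R^-1)%:E)%E]).
  by apply: measurableC; apply: bigcapT_measurable => n;
    exact: measurable_inf_support_lt.
apply/seteqP; split => w /=.
  move=> bh H; have : (b%:E < b%:E)%E; last by rewrite ltxx.
  apply: lt_le_trans bh _; apply/lee_addgt0Pr => e e0.
  have := H (Num.truncn e^-1) I; rewrite /= => /ltW/le_trans; apply.
  rewrite -EFinD lee_fin lerD2l -[leRHS]invrK lef_pV2 ?posrE ?invr_gt0 ?ltr0n//.
  exact: ltW (truncnS_gt _).
move=> H; rewrite ltNge; apply/negP => hb; apply: H => n _ /=.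
by apply: le_lt_trans hb _; rewrite lte_fin ltrDl invr_gt0.
Qed.

(** If the infimum is below [b], some net point has a void cap of height [b + tau]; [leb_cap_ge]
    then costs another 2 tau, and a union bound concludes. *)
Lemma prob_inf_support_lt (b tau : R) : 0 <= b -> 0 < tau -> tau <= 1 ->
  (P [set w | (h w < b%:E)%E] <=
  (((2 * (Num.truncn (d%:R / tau)).+1).+1 ^ d)%:R *
   expR (- (lambda * kappa R d * radial_vol d (1 - (b + 3 * tau) ^+ 2) *
     (tau / 4))))%:E)%E.
Proof.
move=> b0 t0 t1; have [s [ss sA sP]] := sphere_net t0 A1.
pose p := expR (- (lambda * kappa R d * radial_vol d (1 - (b + 3 * tau) ^+ 2) *
  (tau / 4))).
apply: (@le_trans _ _ (P (\bigcup_(v in [set` s]) void X (cap v (b + tau))))).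
  apply: le_measure; rewrite ?inE; first exact: measurable_inf_support_lt.
    by apply: measurable_bigcup_seq => v; apply: (measurable_void pp);
      exact: borel_cap.
  move=> w /inf_support_ltP[u Au ub]; have [v vs uv] := sP u Au.
  exists v => //; rewrite /void/= -subset0 => x [Xx [x1 /= vx]].
  suff : (b%:E < b%:E)%E by rewrite ltxx.
  apply: le_lt_trans ub; apply: (support_ge_cap Xx); split => //=.
  have := @dotv_le_close R d v u x _ t0; rewrite -enorm_le1.
  rewrite -opprB dotvNl dotvNr opprK => /(_ uv x1); lra.
apply: le_trans (prob_bigcup_seq_le (p := p) _ _) _.
- by move=> v; apply: (measurable_void pp); exact: borel_cap.
- move=> v vs; rewrite (prob_void lambda0 pp); [|exact: borel_cap|]; last first.
    by apply: leb_sub_eball1_lty => x [].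
  have E (k r t : R) : lambda * k * r * t = lambda * (k * r * t)
    by rewrite !mulrA.
  rewrite lee_fin ler_expR lerN2 E ler_pM2l//.
  have -> : b + 3 * tau = (b + tau) + 2 * tau by ring.
  by apply: (leb_cap_ge lambda0 pp) => //; [exact: dotA (sA _ vs)|lra].
- by rewrite lee_fin ler_wpM2r ?expR_ge0// ler_nat.
Qed.

(** A single direction suffices: its open cap must be hit, which is at most as likely as the mean
    number of points in it. *)
Lemma prob_inf_support_gt (b : R) : A !=set0 -> 0 < b ->
  (P [set w | (b%:E < h w)%E] <=
  (lambda * kappa R d * radial_vol d (1 - b ^+ 2))%:E)%E.
Proof.
move=> [u Au] b0.
apply: (@le_trans _ _ (P (~` void X (ocap u b)))).
  apply: le_measure; rewrite ?inE; first exact: measurable_inf_support_gt.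
    by apply: measurableC; apply: (measurable_void pp); exact: borel_ocap.
  move=> w /= bh /support_leP; apply/negP; rewrite -ltNge.
  by apply: lt_le_trans bh _; apply: ereal_inf_lbound; exists u.
have lty : (leb (ocap u b) < +oo)%E by apply: leb_sub_eball1_lty => x [].
apply: le_trans (prob_hit_le lambda0 pp (borel_ocap _ _) lty) _.
rewrite lee_fin -mulrA ler_pM2l// -lee_fin fineK ?ge0_fin_numE ?leb_ge0//.
by apply: leb_ocap_le => //; exact: dotA.
Qed.

End inf_support.

Section exponents.
Context {R : realType}.

Lemma radial_vol_expR d (z : R) : 0 < z ->
  radial_vol d z = expR (d%:R / 2 * ln z).
Proof.
move=> z0; rewrite /radial_vol z0 -mulrA expRM_natl mulrC.
by rewrite -{1}[z]lnK// -powR12_sqrt ?expR_ge0// /powR gt_eqF ?expR_gt0// expRK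
  mulrC.
Qed.

(* The 14 d^2 / tau of the Poisson exponent absorbs the 5 d^2 / tau of the
   net. *)
Lemma net_exponent_le (d : nat) (tau Q : R) : (0 < d)%N -> 0 < tau ->
  tau <= 1 ->
  56 * d%:R ^+ 2 / tau ^+ 2 <= Q ->
  ((2 * (Num.truncn (d%:R / tau)).+1).+1 ^ d)%:R * expR (- (Q * (tau / 4))) <=
  expR (- d%:R).
Proof.
move=> d0 t0 t1 Qge.
have d1 : 1 <= d%:R :> R by rewrite ler1n.
set y := d%:R / tau.
have dy : d%:R <= y by rewrite ler_pdivlMr// ler_piMr.
have y1 : 1 <= y := le_trans d1 dy.
have ty : (Num.truncn y)%:R <= y by rewrite truncn_le ltW// (lt_le_trans ltr01).
have base : ((2 * (Num.truncn y).+1).+1%:R : R) <= expR (5 * y).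
  apply: (@le_trans _ _ (5 * y)); last by have := expR_ge1Dx (5 * y); lra.
  by rewrite -natr1 natrM -natr1; lra.
apply: (@le_trans _ _ (expR (d%:R * (5 * y)) * expR (- (Q * (tau / 4))))).
  rewrite ler_wpM2r ?expR_ge0// natrX expRM_natl lerXn2r ?nnegrE ?ler0n
    ?expR_ge0//.
have Qt : 14 * (d%:R * y) <= Q * (tau / 4).
  have -> : 14 * (d%:R * y) = (56 * d%:R ^+ 2 / tau ^+ 2) * (tau / 4).
    by rewrite /y; field; rewrite gt_eqF.
  by rewrite ler_wpM2r// divr_ge0// ltW.
rewrite -expRD ler_expR.
have : d%:R <= d%:R * y by rewrite ler_peMr.
lra.
Qed.

End exponents.

Section min_support.
Context {R : realType} {dT : measure_display} {T : measurableType dT}.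
Context {P : probability T R} {d : nat} {lambda : R} {X : T -> set 'rV[R]_d}.
Context {V : {vspace 'rV[R]_d}}.
Hypothesis lambda0 : 0 < lambda.
Hypothesis pp : poisson_process P lambda X.

Let L := ln (lambda * kappa R d).

Let expRL : lambda * kappa R d = expR L.
Proof. by rewrite lnK// posrE mulr_gt0// kappa_gt0. Qed.

Let sphereV : esphere R d `&` [set u | u \in V] `<=` esphere R d.
Proof. by move=> x []. Qed.

Lemma measurable_min_support_lt (b : R) :
  measurable [set w | (min_support X V w < b%:E)%E].
Proof. exact: (measurable_inf_support_lt pp sphereV). Qed.

Lemma measurable_min_support_gt (b : R) :
  measurable [set w | (b%:E < min_support X V w)%E].
Proof. exact: (measurable_inf_support_gt pp sphereV). Qed.

Lemma prob_min_support_gt (b : R) : (0 < \dim V)%N -> 0 < b < 1 ->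
  (P [set w | (b%:E < min_support X V w)%E] <=
   (expR (L + d%:R / 2 * ln (1 - b ^+ 2)))%:E)%E.
Proof.
move=> V0 /andP[b0 b1]; rewrite expRD -expRL -radial_vol_expR; last by nra.
apply: (prob_inf_support_gt lambda0 pp sphereV _ b0).
have v0 : vpick V != 0 by rewrite vpick0 -dimv_eq0 -lt0n.
have vv0 : 0 < dotv (vpick V) (vpick V).
  rewrite lt_neqAle dotv_ge0 andbT eq_sym; apply: contra v0.
  rewrite /dotv psumr_eq0 => [/allP v0|i _]; last by rewrite -expr2 sqr_ge0.
  apply/eqP/rowP => i; rewrite mxE; apply/eqP; rewrite -sqrf_eq0 expr2.
  exact: v0 (mem_index_enum i).
exists ((enorm (vpick V))^-1 *: vpick V); split => /=;
  last by rewrite memvZ// memv_pick.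
rewrite /esphere/= /enorm dotvZl dotvZr mulrA -expr2 exprVn.
by rewrite sqr_sqrtr ?(ltW vv0)// mulVf ?gt_eqF// sqrtr1.
Qed.

(** The last hypothesis is the logarithm of the condition on [Q] in [net_exponent_le]. *)
Lemma prob_min_support_lt (b tau : R) : (0 < d)%N -> 0 <= b -> 0 < tau ->
  b + 3 * tau < 1 ->
  ln 56 + 2 * ln d%:R - 2 * ln tau <=
    L + d%:R / 2 * ln (1 - (b + 3 * tau) ^+ 2) ->
  (P [set w | (min_support X V w < b%:E)%E] <= (expR (- d%:R))%:E)%E.
Proof.
move=> d0 b0 t0 bt; have t1 : tau <= 1 by lra.
rewrite -ler_expR [expR (L + _)]expRD -expRL -radial_vol_expR; last by nra.
rewrite !expRD expRN !expRM_natl !lnK ?posrE ?ltr0n// => H.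
apply: le_trans (prob_inf_support_lt lambda0 pp sphereV b0 t0 t1) _.
by rewrite lee_fin; apply: net_exponent_le.
Qed.

End min_support.

(** * Asymptotics *)

Section cvg_in_probability.
Context {R : realType} {dT : measure_display} {T : measurableType dT}.
Context {P : probability T R} {m : nat} {lambda : nat -> R}.
Context {X : forall d, T -> set 'rV[R]_d} {V : forall d, {vspace 'rV[R]_d}}.
Hypothesis m2 : (2 <= m)%N.
Hypothesis lambda0 : forall d, (2 <= d)%N -> 0 < lambda d.
Hypothesis pp : forall d, (2 <= d)%N -> poisson_process P (lambda d) (@X d).
Hypothesis dimV : forall d, (m <= d)%N -> \dim (V d) = m.

Let L d := ln (lambda d * kappa R d).
Let h d w := min_support (@X d) (V d) w.

Definition upper_threshold (L b : nat -> R) :=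
  forall M : R, \forall d \near \oo,
  0 < b d < 1 /\ L d + d%:R / 2 * ln (1 - b d ^+ 2) <= - M.

(** The mesh [tau] varies with d, so that it can be a fixed fraction of the deviation allowed in
    each regime. *)
Definition lower_threshold (L b : nat -> R) := exists tau : nat -> R,
  \forall d \near \oo, [/\ 0 <= b d, 0 < tau d, b d + 3 * tau d < 1 &
    ln 56 + 2 * ln d%:R - 2 * ln (tau d) <=
    L d + d%:R / 2 * ln (1 - (b d + 3 * tau d) ^+ 2)].

Lemma near_natr_ge (C : R) : \forall d \near \oo, C <= (d%:R : R).
Proof.
exists (Num.truncn C).+1 => // d /= Cd; apply/ltW/(lt_le_trans (truncnS_gt C)).
by rewrite ler_nat.
Qed.

(** Common reduction of the three regimes: a deviation of [Y] is a crossing by the minimal support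
    function of [b1] upwards or [b2] downwards, so only estimates on these thresholds remain. *)
Lemma cvg_in_probability_min_support (Y : nat -> T -> \bar R) (c e0 : R)
    (b1 b2 : R -> nat -> R) : 0 < e0 ->
  (forall e, 0 < e -> \forall d \near \oo, forall w,
    (e%:E < `|Y d w - c%:E|)%E <->
    ((b1 e d)%:E < h d w)%E \/ (h d w < (b2 e d)%:E)%E) ->
  (forall e, 0 < e -> e < e0 ->
    upper_threshold L (b1 e) /\ lower_threshold L (b2 e)) ->
  cvg_in_probability P Y c.
Proof.
move=> e00 YP bP e e_gt0.
pose E u d := [set w | (u%:E < `|Y d w - c%:E|)%E].
have EE u : 0 < u -> \forall d \near \oo,
    E u d = [set w | ((b1 u d)%:E < h d w)%E] `|`
            [set w | (h d w < (b2 u d)%:E)%E].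
  by move=> /YP; apply: filterS => d H; apply/seteqP; split => w /H.
have mE u : 0 < u -> \forall d \near \oo, measurable (E u d).
  move=> /EE H; near=> d; have d2 : (2 <= d)%N by near: d; exists 2%N.
  rewrite (near H d)//; apply: measurableU.
    exact: measurable_min_support_gt (pp d2) _.
  exact: measurable_min_support_lt (pp d2) _.
(* The deviation event shrinks as [e] grows, so small values of [e] suffice. *)
pose e' := Num.min e (e0 / 2).
have e'0 : 0 < e' by rewrite lt_min e_gt0 divr_gt0.
have e'e0 : e' < e0 by rewrite gt_min; apply/orP; right; lra.
have [up [tau lo]] := bP e' e'0 e'e0.
apply/fine_cvgP; split.
  have H := mE e e_gt0; near=> d; rewrite fin_num_measure//; exact: (near H d).
apply/cvgr0Pnorm_le => del del0.
have H1 := EE e' e'0; have H2 := mE e e_gt0; have H3 := mE e' e'0.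
(* Each tail is made at most del / 2: the upper one by the choice of [M], the lower one by
   exp(-d). *)
have H4 := up (- ln (del / 2)); have H5 := near_natr_ge (- ln (del / 2)).
near=> d.
have d2 : (2 <= d)%N by near: d; exists 2%N.
have dm : (m <= d)%N by near: d; exists m.
have mEe : measurable (E e d) by exact: (near H2 d).
have mEe' : measurable (E e' d) by exact: (near H3 d).
rewrite /= ger0_norm ?fine_ge0// -lee_fin fineK ?fin_num_measure//.
apply: (@le_trans _ _ (P (E e' d))).
  apply: le_measure; rewrite ?inE// => w /=; apply: le_lt_trans.
  by rewrite lee_fin ge_min lexx.
rewrite (near H1 d)//.
have [b10 bM] : 0 < b1 e' d < 1 /\
    L d + d%:R / 2 * ln (1 - b1 e' d ^+ 2) <= - - ln (del / 2) by near: d.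
have [b20 t0 bt Lt] : [/\ 0 <= b2 e' d, 0 < tau d, b2 e' d + 3 * tau d < 1 &
    ln 56 + 2 * ln d%:R - 2 * ln (tau d) <=
    L d + d%:R / 2 * ln (1 - (b2 e' d + 3 * tau d) ^+ 2)] by near: d.
have dV : (0 < \dim (V d))%N by rewrite dimV// (leq_trans _ m2).
apply: le_trans (measureU2 _ _ _) _.
- exact: measurable_min_support_gt (pp d2) _.
- exact: measurable_min_support_lt (pp d2) _.
have -> : del = del / 2 + del / 2 by lra.
rewrite EFinD leeD//.
  apply: le_trans (prob_min_support_gt (lambda0 d2) (pp d2) dV b10) _.
  by rewrite lee_fin -[leRHS]lnK ?posrE ?divr_gt0// ler_expR -[leRHS]opprK.
apply: le_trans (prob_min_support_lt (lambda0 d2) (pp d2) _ b20 t0 bt Lt) _.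
  exact: leq_trans d2.
rewrite lee_fin -[leRHS]lnK ?posrE ?divr_gt0// ler_expR lerNl.
exact: (near H5 d).
Unshelve. all: by end_near.
Qed.

End cvg_in_probability.

Section deviation_events.
Context {R : realType}.
Implicit Types (h : \bar R) (e q c : R).
Local Open Scope ereal_scope.

Lemma lt_abse_sub e q h :
  e%:E < `|h - q%:E| <-> (q + e)%:E < h \/ h < (q - e)%:E.
Proof.
case: h => [r| |] /=.
- rewrite !lte_fin ltr_normr; split.
    by case/orP => H; [left|right]; lra.
  by case=> H; apply/orP; [left|right]; lra.
- by rewrite !ltry; split => // _; left.
- by rewrite ltry !ltNyr; split => // _; right.
Qed.

Lemma lt_abse_ratio e c h : (0 < c)%R ->
  e%:E < `|h * c^-1%:E - 1%:E| <-> ((1 + e) * c)%:E < h \/ h < ((1 - e) * c)%:E.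
Proof.
move=> c0; rewrite lt_abse_sub; case: h => [r| |] /=.
- by rewrite -EFinM !lte_fin ltr_pdivlMr// ltr_pdivrMr.
- by rewrite gt0_mulye ?lte_fin ?invr_gt0// !ltry.
- by rewrite gt0_mulNye ?lte_fin ?invr_gt0// !ltNyr.
Qed.

Lemma lt_abse_defect_ratio e c h : (0 < c)%R ->
  e%:E < `|(1 - h) * c^-1%:E - 1%:E| <->
  (1 - (1 - e) * c)%:E < h \/ h < (1 - (1 + e) * c)%:E.
Proof.
move=> c0; rewrite lt_abse_ratio//; case: h => [r| |] /=.
- rewrite -EFinB !lte_fin; split; case; lra.
- by rewrite ltNyr ltry; split => // _; [left|right].
- by rewrite ltNyr ltry; split => // _; [right|left].
Qed.

End deviation_events.

Section growth.
Context {R : realType}.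

Lemma near_ln_ge (C : R) : \forall d \near \oo, C <= ln (d%:R : R).
Proof.
apply: filterS (near_natr_ge (expR C)) => d H.
by rewrite -ler_expR lnK// posrE (lt_le_trans _ H)// expR_gt0.
Qed.

(** From ln d <= 2 sqrt d, the left side is at most 3 C sqrt d. *)
Lemma near_ln_le (C eps : R) : 0 <= C -> 0 < eps ->
  \forall d \near \oo, C * ln d%:R + C <= eps * (d%:R : R).
Proof.
move=> C0 e0.
apply: filterS2 (near_natr_ge 1) (near_natr_ge ((3 * C / eps) ^+ 2)) => d d1 dC.
have d0 : 0 < d%:R :> R by lra.
pose s := Num.sqrt (d%:R : R).
have sd : s ^+ 2 = d%:R by rewrite sqr_sqrtr// ltW.
have s1 : 1 <= s by rewrite -(@sqrtr1 R) ler_wsqrtr.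
have sC : 3 * C <= eps * s.
  rewrite [leRHS]mulrC -ler_pdivrMr// -[leLHS]ger0_norm ?divr_ge0 ?(ltW e0)//;
    last lra.
  by rewrite -sqrtr_sqr ler_wsqrtr.
have lns : ln d%:R <= 2 * s.
  rewrite -sd lnXn ?mulr2n; last by lra.
  have := @le_ln1Dx R (s - 1); have -> : 1 + (s - 1) = s by lra.
  lra.
have : C * ln d%:R <= C * (2 * s) by rewrite ler_wpM2l.
rewrite -sd; nra.
Qed.

(** This is ln (1 + t) <= t at t = z / (1 - z), where 1 + t = 1 / (1 - z). *)
Lemma ln1B_ge (z : R) : z < 1 -> - (z / (1 - z)) <= ln (1 - z).
Proof.
move=> z1; have z0 : 0 < 1 - z by lra.
rewrite lerNl -lnV ?posrE//.
have -> : ln (1 - z)^-1 = ln (1 + z / (1 - z)) by congr ln; field; lra.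
by apply: le_ln1Dx; rewrite ltr_pdivlMr//; lra.
Qed.

End growth.

(** * Thresholds in the three regimes *)

Section thresholds.
Context {R : realType}.
Variable L : nat -> R.

(** Let rho^2 = 2 L / d, which tends to 0. At b = k rho, the term d/2 ln (1 - b^2) is close to - k^2
    L, so the exponent is about (1 - k^2) L and changes sign at k = 1. *)
Lemma subexponential_thresholds (e : R) :
  much_less (fun d => ln d%:R) L -> much_less L (fun d => d%:R) ->
  0 < e -> e < 1 / 2 ->
  upper_threshold L (fun d => (1 + e) * Num.sqrt (2 / d%:R * L d)) /\
  lower_threshold L (fun d => (1 - e) * Num.sqrt (2 / d%:R * L d)).
Proof.
move=> lnL Ld e0 e1; set rho := fun d => Num.sqrt (2 / d%:R * L d).
have common : \forall d \near \oo, [/\ 1 <= (d%:R : R), 1 <= L d,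
    0 < rho d, rho d ^+ 2 = 2 / d%:R * L d & rho d ^+ 2 <= e / 2].
  have e4 : 0 < e / 4 by lra.
  apply: filterS3 (near_natr_ge 1) (filterI (lnL 1 ltr01) (near_ln_ge 1)) (Ld _
    e4) => d d1 [lL l1] dL.
  rewrite mul1r in lL.
  have r0 : 0 < 2 / d%:R * L d by rewrite mulr_gt0 ?divr_gt0//; lra.
  have r2 : rho d ^+ 2 = 2 / d%:R * L d by rewrite sqr_sqrtr// ltW.
  split=> //; [lra|by rewrite sqrtr_gt0|].
  rewrite r2 mulrAC ler_pdivrMr; lra.
split=> [M|].
  have lM := near_ln_ge (M / (2 * e)).
  apply: filterS3 common lM (lnL 1 ltr01) => d [d1 L1 r0 r2 re] lM' lL.
  rewrite mul1r in lL.
  have b2 : ((1 + e) * rho d) ^+ 2 <= (1 + e) ^+ 2 * (e / 2).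
    by rewrite exprMn ler_wpM2l// sqr_ge0.
  have b21 : ((1 + e) * rho d) ^+ 2 < 1 by apply: le_lt_trans b2 _; nra.
  have b0 : 0 < (1 + e) * rho d by rewrite mulr_gt0//; lra.
  split.
    by rewrite b0/= -(ltr_pXn2r (n := 2))// ?nnegrE ?expr1n// ltW.
  have : ln (1 - ((1 + e) * rho d) ^+ 2) <= - ((1 + e) * rho d) ^+ 2.
    by apply: le_ln1Dx; lra.
  move=> H.
  have : d%:R / 2 * ln (1 - ((1 + e) * rho d) ^+ 2) <=
      d%:R / 2 * (- ((1 + e) * rho d) ^+ 2).
    by rewrite ler_wpM2l// divr_ge0//; lra.
  have -> : d%:R / 2 * (- ((1 + e) * rho d) ^+ 2) = - (1 + e) ^+ 2 * L d.
    by rewrite exprMn r2; field; lra.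
  have : M <= (2 * e) * L d by rewrite mulrC -ler_pdivrMr; lra.
  nra.
(* With this mesh b + 3 tau = (1 - e / 2) rho. As -2 ln rho <= ln d, the left side of the condition
   is at most 4 ln d <= e / 2 L. *)
exists (fun d => e / 6 * rho d).
have e8 : 0 < e / 8 by lra.
apply: filterS3 common (lnL _ e8) (near_ln_ge (ln 56 + 2 * ln (6 / e))) =>
  d [d1 L1 r0 r2 re] lL lC.
have -> : (1 - e) * rho d + 3 * (e / 6 * rho d) = (1 - e / 2) * rho d by field.
have r1 : rho d < 1 by nra.
split; [by rewrite mulr_ge0//; lra|by rewrite mulr_gt0//; lra|nra|].
set z := ((1 - e / 2) * rho d) ^+ 2.
have zE : z = (1 - e / 2) ^+ 2 * rho d ^+ 2 by rewrite /z exprMn.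
have z0 : 0 <= z by rewrite sqr_ge0.
have ze : z <= e / 2 by rewrite zE; nra.
(* The denominator cancels one of the two factors 1 - e / 2 of [z], so the exponent is still at
   least e / 2 L. *)
have H1 : - (z / (1 - e / 2)) <= ln (1 - z).
  apply: le_trans (ln1B_ge _); last by lra.
  by rewrite lerN2 ler_wpM2l// lef_pV2 ?posrE; lra.
have H2 : d%:R / 2 * - (z / (1 - e / 2)) = - ((1 - e / 2) * L d).
  by rewrite zE r2; field; lra.
have H3 : d%:R / 2 * - (z / (1 - e / 2)) <= d%:R / 2 * ln (1 - z).
  by rewrite ler_wpM2l// divr_ge0//; lra.
have H4 : - 2 * ln (e / 6 * rho d) <= 2 * ln (6 / e) + ln d%:R.
  have -> : ln (e / 6 * rho d) = - ln (6 / e) + ln (rho d).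
    rewrite lnM ?posrE ?divr_gt0// -lnV ?posrE ?divr_gt0//.
    by rewrite invf_div.
  have : - ln d%:R <= 2 * ln (rho d).
    rewrite -lnV ?posrE; last by lra.
    rewrite mulr_natl -lnXn// ler_ln ?posrE ?invr_gt0 ?exprn_gt0//; last by lra.
    rewrite r2 mulrAC ler_peMl ?invr_ge0; lra.
  lra.
rewrite H2 in H3; lra.
Qed.

(** Divided by d, the exponent tends to y + ln (1 - b^2) / 2, which decreases in b and vanishes at b
    = q. The bound on [e] keeps both thresholds in ]0, 1[. *)
Lemma linear_thresholds (y e : R) : 0 < y ->
  asymp_equiv L (fun d => d%:R * y) ->
  let q := Num.sqrt (1 - expR (- 2 * y)) in
  0 < e -> e < Num.min q (1 - q) ->
  upper_threshold L (fun=> q + e) /\ lower_threshold L (fun=> q - e).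
Proof.
move=> y0 Ly q e0; rewrite lt_min => /andP[eq e1].
have ey1 : expR (- 2 * y) < 1 by rewrite expR_lt1; nra.
have q2 : q ^+ 2 = 1 - expR (- 2 * y) by rewrite sqr_sqrtr; lra.
have lnq : ln (1 - q ^+ 2) = - 2 * y by rewrite q2 subKr expRK.
have Lnear (k : R) : 0 < k ->
    \forall d \near \oo, - (k * d%:R) <= L d - d%:R * y <= k * d%:R.
  move=> k0; have ky : 0 < k / y by rewrite divr_gt0.
  apply: filterS (Ly _ ky) => d.
  have -> : k / y * (d%:R * y) = k * d%:R by field; rewrite gt_eqF.
  by rewrite ler_norml.
split.
  move=> M.
  have k0 : 0 < (- 2 * y - ln (1 - (q + e) ^+ 2)) / 2.
    rewrite divr_gt0// subr_gt0 -lnq ltr_ln ?posrE; nra.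
  (* The limit of the exponent over d is [- k]; half of it absorbs the error L - d y. *)
  set k := _ / 2 in k0.
  have k2 : 0 < k / 2 by lra.
  apply: filterS2 (Lnear _ k2) (near_natr_ge (M / (k / 2))) => d /andP[_ Ld] dM.
  split; first by apply/andP; split; lra.
  have -> : ln (1 - (q + e) ^+ 2) = - 2 * y - 2 * k by rewrite /k; lra.
  have : M <= d%:R * (k / 2) by rewrite -ler_pdivrMr.
  by lra.
exists (fun=> e / 6).
have -> : q - e + 3 * (e / 6) = q - e / 2 by field.
have k0 : 0 < (ln (1 - (q - e / 2) ^+ 2) + 2 * y) / 2.
  rewrite divr_gt0// -ltrBlDr sub0r -mulNr -lnq ltr_ln ?posrE; nra.
set k := _ / 2 in k0.
have k2 : 0 < k / 2 by lra.
have [C C0 CE] : exists2 C : R, 0 <= C & 2 <= C /\ ln 56 - 2 * ln (e / 6) <= C.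
  set C := ln 56 - 2 * ln (e / 6).
  have C0 := normr_ge0 C; have CC := ler_norm C.
  by exists (2 + `|C|); first lra; split; lra.
apply: filterS3 (Lnear _ k2) (near_ln_le C0 k2) (near_ln_ge 0) =>
  d /andP[Ld _] lC l0.
split; [lra|lra|lra|].
have -> : ln (1 - (q - e / 2) ^+ 2) = - 2 * y + 2 * k by rewrite /k; lra.
have : 2 * ln d%:R <= C * ln d%:R :> R by rewrite ler_wpM2r//; case: CE.
case: CE => _ CE; lra.
Qed.

(** At b = 1 - w with w = k eta, 1 - b^2 is about 2 w and ln (2 eta) = - 2 l, so the exponent is
    about l + d/2 ln k. Since L << d^2, l = L / (d + 1) is negligible against d and the sign of ln k
    decides. *)
Lemma superlinear_thresholds (e : R) :
  much_less (fun d => d%:R) L -> much_less L (fun d => d%:R ^+ 2) ->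
  0 < e -> e < 1 / 2 ->
  let eta := fun d : nat => 2^-1 * expR (- 2 / d.+1%:R * L d) in
  upper_threshold L (fun d => 1 - (1 - e) * eta d) /\
  lower_threshold L (fun d => 1 - (1 + e) * eta d).
Proof.
move=> dL Ld e0 e1 eta.
pose l d := L d / d.+1%:R.
have etaE d : eta d = 2^-1 * expR (- 2 * l d).
  by rewrite /eta /l; congr (_ * expR _); rewrite mulrAC mulrA.
have dl d : d%:R / 2 * (- 2 * l d) = l d - L d.
  by rewrite /l -natr1; field; have := ler0n R d; lra.
have common (k : R) : 0 < k ->
    \forall d \near \oo, [/\ 1 <= (d%:R : R), 0 <= l d,
    l d <= k * d%:R, 0 < eta d & eta d <= e / 8].
  move=> k0; have K0 : 0 < e / 4 by lra.
  apply: filterS3 (near_natr_ge 1) (dL _ K0) (Ld _ k0) => d d1 H1 H2.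
  have L0 : 0 <= L d by rewrite -(pmulr_rge0 _ K0); lra.
  have dS : 0 < d.+1%:R :> R by rewrite ltr0n.
  have l0 : 0 <= l d by rewrite divr_ge0// ltW.
  split=> //.
  - rewrite ler_pdivrMr// (le_trans H2)// -mulrA expr2 -natr1.
    by rewrite ler_wpM2l ?(ltW k0)// ler_wpM2l; lra.
  - by rewrite mulr_gt0 ?expR_gt0// invr_gt0.
  - have l2 : 4 / e <= 2 * l d.
      rewrite /l mulrA ler_pdivlMr// -natr1.
      have : d%:R * (4 / e) <= L d.
        by rewrite -(ler_pM2l K0) mulrCA mulrA;
          have -> : d%:R * (e / 4) * (4 / e) = d%:R by field; lra.
      nra.
    rewrite etaE mulNr expRN.
    have : (expR (2 * l d))^-1 <= (4 / e)^-1.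
      rewrite lef_pV2 ?posrE ?expR_gt0 ?divr_gt0//.
      by have := expR_ge1Dx (2 * l d); lra.
    by rewrite invf_div; lra.
have lneta d : ln (2 * eta d) = - 2 * l d.
  by rewrite etaE mulrA mulfV// mul1r expRK.
split=> [M|].
  have e4 : 0 < e / 4 by lra.
  apply: filterS2 (common _ e4) (near_natr_ge (M / (e / 4))) =>
    d [d1 l0 lk t0 te] dM.
  split; first by apply/andP; split; nra.
  have : ln (1 - (1 - (1 - e) * eta d) ^+ 2) <= - e - 2 * l d.
    have h1 : ln (1 - e) <= - e by apply: le_ln1Dx; lra.
    apply: (@le_trans _ _ (ln ((1 - e) * (2 * eta d)))).
      have w0 : 0 < (1 - e) * eta d by rewrite mulr_gt0//; lra.
      have w1 : (1 - e) * eta d < 1 by nra.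
      have -> : (1 - e) * (2 * eta d) = 2 * ((1 - e) * eta d) by ring.
      move: w0 w1; set w := (1 - e) * eta d => w0 w1.
      by rewrite ler_ln ?posrE; nra.
    by rewrite lnM ?posrE ?lneta; lra.
  move=> H.
  have : d%:R / 2 * ln (1 - (1 - (1 - e) * eta d) ^+ 2) <=
      d%:R / 2 * (- e - 2 * l d).
    by rewrite ler_wpM2l// divr_ge0//; lra.
  have := dl d.
  have : M <= d%:R * (e / 4) by rewrite -ler_pdivrMr.
  lra.
(* The coefficient 1 + e / 2 of [eta] is lowered to 1 + e / 4 to pay for the square in 1 - (1 - w)^2
   = 2 w - w^2. *)
pose k := ln (1 + e / 4).
have k0 : 0 < k by rewrite ln_gt0; lra.
have k8 : 0 < k / 16 by lra.
exists (fun d => e / 6 * eta d).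
pose C0 := 2 + `|ln 56 - 2 * ln (e / 12)|.
have C00 : 0 <= C0 by rewrite addr_ge0.
(* The mesh contributes 4 l to the left side, and the exponent gives one l back; the remaining 3 l
   and the logarithms take k / 16 of d each, within k / 2. *)
apply: filterS3 (common _ k8) (near_ln_le C00 k8) (near_ln_ge 0) =>
  d [d1 l0 lk t0 te] lC ln0.
have -> : 1 - (1 + e) * eta d + 3 * (e / 6 * eta d) = 1 - (1 + e / 2) * eta d
  by field.
split; [nra|by rewrite mulr_gt0//; lra|nra|].
have H : k - 2 * l d <= ln (1 - (1 - (1 + e / 2) * eta d) ^+ 2).
  have -> : k - 2 * l d = k + ln (2 * eta d) by rewrite lneta; ring.
  rewrite /k -lnM ?posrE; [|lra|lra].
  have w0 : 0 < (1 + e / 2) * eta d by rewrite mulr_gt0//; lra.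
  have w1 : (1 + e / 2) * eta d <= e / 4 by nra.
  have w2 : (1 + e / 4) * (2 * eta d) * (1 + e / 2) =
    2 * (1 + e / 4) * ((1 + e / 2) * eta d) by ring.
  move: w0 w1 w2; set w := (1 + e / 2) * eta d => w0 w1 w2.
  rewrite ler_ln ?posrE; [|nra..].
  rewrite -(@ler_pM2r _ (1 + e / 2)) ?w2; nra.
have H2 : d%:R / 2 * (k - 2 * l d) <=
    d%:R / 2 * ln (1 - (1 - (1 + e / 2) * eta d) ^+ 2).
  by rewrite ler_wpM2l// divr_ge0//; lra.
have := dl d.
have -> : ln (e / 6 * eta d) = ln (e / 12) - 2 * l d.
  have -> : e / 6 * eta d = e / 12 * (2 * eta d) by field.
  by rewrite lnM ?posrE ?lneta; lra.
have : ln 56 - 2 * ln (e / 12) <= C0.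
  by have := ler_norm (ln 56 - 2 * ln (e / 12)); rewrite /C0; lra.
have : 2 * ln d%:R <= C0 * ln d%:R :> R by rewrite ler_wpM2r// lerDl.
lra.
Qed.

End thresholds.

(** * The value of x in each regime *)

Section ratio_limits.
Context {R : realType}.
Variable L : nat -> R.

Lemma lim_ratio_asymp_equiv (y : R) :
  0 < y -> asymp_equiv L (fun d => d%:R * y) ->
  limn (fun d => (L d / d%:R)%:E) = y%:E.
Proof.
move=> y0 Ly; apply/cvg_lim => //; apply: cvg_EFin; first exact: nearW.
apply/cvgrPdist_le => e e0; have ey : 0 < e / y by rewrite divr_gt0.
apply: filterS2 (near_natr_ge 1) (Ly _ ey) => d d1 H.
have -> : y - L d / d%:R = - (L d - d%:R * y) / d%:R by field; lra.
rewrite normrM normfV normrN (ger0_norm (ler0n _ _)).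
rewrite ler_pdivrMr ?(lt_le_trans ltr01)//; apply: le_trans H _.
suff -> : e / y * (d%:R * y) = e * d%:R by [].
by field; rewrite gt_eqF.
Qed.

Lemma lim_ratio_much_less : (\forall d \near \oo, 0 <= L d) ->
  much_less L (fun d => d%:R) -> limn (fun d => (L d / d%:R)%:E) = 0%E.
Proof.
move=> L0 Ld; apply/cvg_lim => //; apply: cvg_EFin; first exact: nearW.
apply/cvgrPdist_le => e e0; apply: filterS3 L0 (near_natr_ge 1) (Ld _ e0) =>
  d L0 d1 H.
rewrite sub0r normrN ger0_norm ?divr_ge0// ler_pdivrMr//; lra.
Qed.

Lemma lim_ratio_much_greater : much_less (fun d => d%:R) L ->
  limn (fun d => (L d / d%:R)%:E) = +oo%E.
Proof.
move=> dL; apply/cvg_lim => //; apply/cvgeryP/cvgryPge => A.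
pose B := Num.max A 1; have B0 : 0 < B by rewrite lt_max ltr01 orbT.
have BV : 0 < B^-1 by rewrite invr_gt0.
apply: filterS2 (near_natr_ge 1) (dL _ BV) => d d1;
  rewrite mulrC ler_pdivlMr// => H.
rewrite ler_pdivlMr; last by lra.
apply: le_trans H; rewrite mulrC ler_wpM2l// /B le_max lexx//.
Qed.

End ratio_limits.

Theorem corollary4 (R : realType) (dT : measure_display)
    (T : measurableType dT) (P : probability T R)
    (m : nat) (lambda : nat -> R) (X : forall d : nat, T -> set 'rV[R]_d)
    (V : forall d : nat, {vspace 'rV[R]_d}) :
  let L := fun d : nat => ln (lambda d * kappa R d) in
  (2 <= m)%N ->
  (forall d : nat, (2 <= d)%N -> 0 < lambda d) ->
  (forall d : nat, (2 <= d)%N -> poisson_process P (lambda d) (X d)) ->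
  (forall d : nat, (m <= d)%N -> \dim (V d) = m) ->
  [\/ much_less (fun d => ln d%:R) L /\ much_less L (fun d => d%:R),
      exists2 x : R, 0 < x & asymp_equiv L (fun d => d%:R * x)
    | exists gamma : R, [/\ 0 < gamma < 1 / 2,
        much_less (fun d => d%:R) L &
        much_less L (fun d => d%:R `^ (3 / 2 - gamma))]] ->
  let h := fun (d : nat) (w : T) => min_support (X d) (V d) w in
  let x : \bar R := limn (fun d : nat => (L d / d%:R)%:E) in
  [/\ x = 0%E ->
        cvg_in_probability P
          (fun d w => h d w * ((Num.sqrt (2 / d%:R * L d))^-1)%:E)%E 1,
      forall y : R, 0 < y -> x = y%:E ->
        cvg_in_probability P h (Num.sqrt (1 - expR (- 2 * y)))
    & x = +oo%E ->
        cvg_in_probability P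
          (fun d w => (1 - h d w) *
             ((2^-1 * (lambda d * kappa R d) `^ (- 2 / d.+1%:R))^-1)%:E)%E 1].
Proof.
move=> L m2 lambda0 pp dimV HL h x.
have L_gt0 d : (2 <= d)%N -> 0 < lambda d * kappa R d.
  by move=> d2; rewrite mulr_gt0 ?lambda0// kappa_gt0.
have half : 0 < 1 / 2 :> R by lra.
(* The conclusions are indexed by [x], so each regime is paired with the value it forces; the other
   two conclusions then have a contradictory premise. In the third regime, 3 / 2 - gamma < 2 gives L
   << d^2. *)
have [[x0 [lnL Ld]]|[y [x0 y0 Ly]]|[x0 dL Ld]] :
  [\/ x = 0%E /\ much_less (fun d => ln d%:R) L /\ much_less L (fun d => d%:R),
      exists y : R, [/\ x = y%:E, 0 < y & asymp_equiv L (fun d => d%:R * y)]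
    | [/\ x = +oo%E, much_less (fun d => d%:R) L &
        much_less L (fun d => d%:R ^+ 2)]].
  case: HL => [[lnL Ld]|[y y0 Ly]|[g [/andP[g0 g1] dL Ld]]].
  - apply: Or31; split=> //; apply: lim_ratio_much_less Ld.
    apply: filterS2 (lnL 1 ltr01) (near_ln_ge 0) => d; rewrite mul1r; lra.
  - by apply: Or32; exists y; split=> //; exact: lim_ratio_asymp_equiv.
  - apply: Or33; split=> // [|e e0]; first exact: lim_ratio_much_greater.
    apply: filterS2 (near_natr_ge 1) (Ld _ e0) => d d1 /le_trans; apply.
    rewrite ler_wpM2l ?(ltW e0)// -powR_mulrn ?ler0n//.
    by rewrite ler_powR//; lra.
- split=> [_|y y0|]; rewrite ?x0//; last first.
    by case=> yE; rewrite -yE ltxx in y0.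
  apply: (cvg_in_probability_min_support m2 lambda0 pp dimV half
    (b1 := fun e d => (1 + e) * Num.sqrt (2 / d%:R * L d))
    (b2 := fun e d => (1 - e) * Num.sqrt (2 / d%:R * L d))) => [e e0|e e0 e1];
      last first.
    exact: subexponential_thresholds.
  apply: filterS3 (near_natr_ge 1) (lnL 1 ltr01) (near_ln_ge 1) => d d1.
  rewrite mul1r => lL l1 w; apply: lt_abse_ratio.
  by rewrite sqrtr_gt0 mulr_gt0 ?divr_gt0//; lra.
- split=> [|y' _|]; rewrite x0 => //.
    by case=> yE; rewrite yE ltxx in y0.
  case=> <-; set q := Num.sqrt _.
  have ey1 : expR (- 2 * y) < 1 by rewrite expR_lt1; lra.
  have q1 : 0 < Num.min q (1 - q).
    rewrite lt_min sqrtr_gt0 subr_gt0 ey1/= subr_gt0 -(@sqrtr1 R) ltr_sqrt//.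
    by rewrite gtrBl expR_gt0.
  apply: (cvg_in_probability_min_support m2 lambda0 pp dimV q1
    (b1 := fun e _ => q + e) (b2 := fun e _ => q - e)) => [e e0|e e0 e1].
    by apply: nearW => d w; exact: lt_abse_sub.
  exact: linear_thresholds.
- split=> [|y y0|_]; [by rewrite x0|by rewrite x0|].
  apply: (cvg_in_probability_min_support m2 lambda0 pp dimV half
    (b1 := fun e d => 1 - (1 - e) * (2^-1 * expR (- 2 / d.+1%:R * L d)))
    (b2 := fun e d => 1 - (1 + e) * (2^-1 * expR (- 2 / d.+1%:R * L d)))) =>
      [e e0|e e0 e1]; last first.
    exact: superlinear_thresholds.
  near=> d => w.
  have -> : (lambda d * kappa R d) `^ (- 2 / d.+1%:R) =
      expR (- 2 / d.+1%:R * L d).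
    by rewrite /powR gt_eqF// L_gt0//; near: d; exists 2%N.
  by apply: lt_abse_defect_ratio; rewrite mulr_gt0 ?expR_gt0// invr_gt0.
Unshelve. all: by end_near.
Qed.
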